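(* Let a single qubit be coupled to an arbitrary quantum bath with Hilbert space $\mathcal{H}_B$ through a pure dephasing Hamiltonian $$H=-\tfrac12 B\,\sigma_z+H_B+H_{SB}\,\sigma_z,$$ where $B$ is a real constant and $H_B$, $H_{SB}$ are Hermitian operators acting on the bath. Let $U_Q(t)=\mathcal{T}\exp\big(-i\int_0^tH(t')\,dt'\big)$ be the total evolution operator (equal to $e^{-iHt}$ when $H$ does not depend on time). Let the initial state be a product $\rho^S(0)\otimes\rho^B(0)$ of a qubit state and a bath state, and let $\rho^{(Q)}(t)=\mathrm{Tr}_B\big[U_Q(t)\,(\rho^S(0)\otimes\rho^B(0))\,U_Q(t)^\dagger\big]$ be the reduced density matrix of the qubit. Let $T^{(Q)}(t)$ be the quantum transfer matrix, i.e. the matrix, determined by $H$ and $\rho^B(0)$, of the linear relation $n_i(t)=\sum_kT^{(Q)}_{ik}(t)\,n_k(0)$ between the initial and final expanded Bloch vectors of the qubit. It satisfies $T^{(Q)}_{xx}=T^{(Q)}_{yy}$ and $T^{(Q)}_{yx}=-T^{(Q)}_{xy}$. Put $$c=T^{(Q)}_{xx},\qquad s=T^{(Q)}_{yx},\qquad r^2=c^2+s^2,\qquad \beta=\frac{\sqrt{1-r^2}}{r},$$ $$\Phi_1(t)=\tan^{-1}\Big(\frac{s-\beta c}{c+\beta s}\Big),\qquad \Phi_2(t)=\tan^{-1}\Big(\frac{s+\beta c}{c-\beta s}\Big),$$ where $\Phi_1$ and $\Phi_2$ are the angles of the unit vectors $(c+\beta s,\,s-\beta c)$ and $(c-\beta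 s,\,s+\beta c)$, followed continuously in $t$ from $\Phi_1(0)=\Phi_2(0)=0$. Define $$h_1=\frac{\partial\Phi_1}{\partial t}+B,\qquad h_2=\frac{\partial\Phi_2}{\partial t}+B .$$ Then the dynamics of this open quantum system can be simulated by the classical noise model $$H_{Cl}(t)=-\tfrac12B\sigma_z+\tfrac12h(t)\sigma_z,$$ in which the random function $h$ equals $h_1$ with probability $\tfrac12$ and $h_2$ with probability $\tfrac12$: the density matrix of the qubit is the same for the two models at all times. That is, for every initial qubit density matrix and all times $t$, $$\rho^{(Q)}(t)=\tfrac12\,U_1(t)\,\rho^S(0)\,U_1(t)^\dagger+\tfrac12\,U_2(t)\,\rho^S(0)\,U_2(t)^\dagger,$$ where, for $k=1,2$, $U_k(t)=\exp\Big(-\tfrac{i}{2}\sigma_z\int_0^t\big(-B+h_k(t')\big)\,dt'\Big)$.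
   Context: $\sigma_x,\sigma_y,\sigma_z$ are the Pauli matrices acting on the qubit and $\sigma_0$ is the $2\times2$ identity; $\mathrm{Tr}_B$ is the trace over the bath; $\mathcal{T}$ denotes time-ordering; $i$ in exponents is the imaginary unit; $\hbar=1$. Operators written without tensor factors act as the identity on the other factor. The expanded Bloch vector of a qubit density matrix $\rho^S$ is $(n_0,n_x,n_y,n_z)=(1,n_x,n_y,n_z)$ with $\rho^S=\tfrac12\sum_in_i\sigma_i$, the sum running over $i=0,x,y,z$. A classical dephasing noise model evolves the qubit density matrix by averaging, over a probability distribution of noise histories $h$ (real functions of time), the unitary evolutions $\exp\big(-i\int_0^tH_{Cl}(t')\,dt'\big)$ generated by $H_{Cl}(t)=-\tfrac12B\sigma_z+\tfrac12h(t)\sigma_z$. The bath may be finite-dimensional (the case treated explicitly, for simplicity) or infinite-dimensional.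
   Formalization: The claim at time t is made when r is nonzero on [0,t] (otherwise β is undefined) and, if H_SB is not bounded on (0,t), when Φ_1 and Φ_2 are absolutely continuous on [0,t], since otherwise h_1, h_2 need not exist; the derivatives ∂Φ_k/∂t are taken almost everywhere. *)

(* Defs.v *)
From HB Require Import structures.
From mathcomp Require Import all_boot all_order all_algebra finmap.
From mathcomp Require Import sesquilinear.
From mathcomp Require Import complex.
From mathcomp Require Import all_classical all_reals all_analysis.
From mathcomp.analysis.showcase Require summability.

Set Implicit Arguments.
Unset Strict Implicit.
Unset Printing Implicit Defensive.

Import Order.TTheory GRing.Theory Num.Theory.
Import numFieldNormedType.Exports.

Local Open Scope classical_set_scope.
Local Open Scope complex_scope.
Local Open Scope ring_scope.

(** * Qubit *)

(* Basis index 0 is the eigenvector of sigma_z with eigenvalue +1. *)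
Definition sigma_x (R : realType) : 'M[R[i]]_2 :=
  \matrix_(a, b) (a != b)%:R.

Definition sigma_y (R : realType) : 'M[R[i]]_2 :=
  \matrix_(a, b) if a == b then 0 else if a == 0 then - 'i%C else 'i%C.

Definition sigma_z (R : realType) : 'M[R[i]]_2 :=
  \matrix_(a, b) if a != b then 0 else if a == 0 then 1 else -1.

(* The indices 0, 1, 2, 3 of 'I_4 stand for 0, x, y, z. *)
Definition pauli (R : realType) (k : 'I_4) : 'M[R[i]]_2 :=
  nth 0 [:: 1%:M; sigma_x R; sigma_y R; sigma_z R] k.

Definition idx_x : 'I_4 := inord 1.
Definition idx_y : 'I_4 := inord 2.

Definition density_matrix (R : realType) (rho : 'M[R[i]]_2) : Prop :=
  [/\ rho ^t Num.conj = rho,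
      forall v : 'cV[R[i]]_2, 0 <= (v ^t Num.conj *m rho *m v) 0 0
    & \tr rho = 1]%sesqui.

Definition bloch_vector (R : realType) (rho : 'M[R[i]]_2) (n : 'cV[R]_4) : Prop :=
  rho = (2^-1) *: \sum_k (n k 0)%:C *: pauli R k.

Definition expm (R : realType) (A : 'M[R[i]]_2) : 'M[R[i]]_2 :=
  limn (series (fun k => (k`!%:R)^-1 *: A ^+ k)).

(** * Bath *)

(* A complex Hilbert space is a complete normed module over R[i] whose norm
   comes from the inner product [dot].  Library forms are linear in the FIRST
   argument: [dot x y] is the physicists' <y|x>. *)
Definition hilbert_space (R : realType) (V : completeNormedModType R[i])
    (dot : {dot V for Num.conj}) : Prop :=
  forall x : V, `|x| ^+ 2 = dot x x.

(* Unconditional expansions over an arbitrary index type, so that finite,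
   countable and uncountable bases are all covered. *)
Definition orthonormal_basis (R : realType) (V : completeNormedModType R[i])
    (dot : {dot V for Num.conj}) (I : choiceType) (e : I -> V) : Prop :=
  (forall j k, dot (e j) (e k) = (j == k)%:R) /\
  forall x : V, summability.partial_sum (fun j => dot x (e j) *: e j)
                  @ summability.totally --> x.

(* Possibly unbounded operators: values of [act] outside [dom] are irrelevant.
   An everywhere defined operator has [dom = setT]. *)
Record partial_operator (V : Type) := PartialOperator {
  dom : set V;
  act : V -> V }.

Definition hermitian_operator (R : realType) (V : completeNormedModType R[i])
    (dot : {dot V for Num.conj}) (X : partial_operator V) : Prop :=
  [/\ dense (dom X),
      forall (a : R[i]) x y, dom X x -> dom X y -> dom X (a *: x + y),
      forall (a : R[i]) x y, dom X x -> dom X y ->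
        act X (a *: x + y) = a *: act X x + act X y
    & forall x y, dom X x -> dom X y -> dot (act X x) y = dot x (act X y)].

(* It is enough to compute the trace in one orthonormal basis, the operator
   being positive. *)
Definition density_operator (R : realType) (V : completeNormedModType R[i])
    (dot : {dot V for Num.conj}) (I : choiceType) (e : I -> V)
    (rho : V -> V) : Prop :=
  [/\ linear rho, continuous rho,
      forall x, 0 <= dot (rho x) x
    & summability.partial_sum (fun j => dot (rho (e j)) (e j) : R[i]^o)
        @ summability.totally --> (1 : R[i]^o)].

(** * Qubit and bath: C^2 (x) V is represented as 'I_2 -> V *)

Definition dot2 (R : realType) (V : completeNormedModType R[i])
    (dot : {dot V for Num.conj}) (psi phi : 'I_2 -> V) : R[i] :=
  \sum_a dot (psi a) (phi a).

Definition dense2 (R : realType) (V : completeNormedModType R[i])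
    (D : set ('I_2 -> V)) : Prop :=
  forall psi (eps : R), 0 < eps ->
    exists2 phi, D phi & forall a, `|psi a - phi a| < eps%:C.

Definition tensor (R : realType) (V : completeNormedModType R[i])
    (A : 'M[R[i]]_2) (X : V -> V) (psi : 'I_2 -> V) : 'I_2 -> V :=
  fun a => \sum_b A a b *: X (psi b).

Definition ket (R : realType) (V : completeNormedModType R[i])
    (b : 'I_2) (x : V) : 'I_2 -> V :=
  fun a => (a == b)%:R *: x.

Definition adjoint (R : realType) (V : completeNormedModType R[i])
    (dot : {dot V for Num.conj}) (A : ('I_2 -> V) -> ('I_2 -> V)) :
    ('I_2 -> V) -> ('I_2 -> V) :=
  fun psi => xget 0 [set phi | forall chi, dot2 dot (A chi) psi = dot2 dot chi phi].

Definition unitary (R : realType) (V : completeNormedModType R[i])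
    (dot : {dot V for Num.conj}) (A : ('I_2 -> V) -> ('I_2 -> V)) : Prop :=
  [/\ linear A,
      forall psi phi, dot2 dot (A psi) (A phi) = dot2 dot psi phi
    & forall psi, exists phi, A phi = psi].

Definition partial_trace (R : realType) (V : completeNormedModType R[i])
    (dot : {dot V for Num.conj}) (I : choiceType) (e : I -> V)
    (X : ('I_2 -> V) -> ('I_2 -> V)) : 'M[R[i]]_2 :=
  \matrix_(a, b) summability.sum (fun j => dot (X (ket b (e j)) a) (e j) : R[i]^o).

(** * Dynamics *)

Definition dephasing_hamiltonian (R : realType) (V : completeNormedModType R[i])
    (B : R) (HB HSB : partial_operator V) : partial_operator ('I_2 -> V) :=
  {| dom := [set psi | forall a, dom HB (psi a) /\ dom HSB (psi a)];
     act := fun psi => (- (2^-1 * B))%:C *: tensor (sigma_z R) idfun psi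
                       + tensor 1%:M (act HB) psi
                       + tensor (sigma_z R) (act HSB) psi |}.

(* The time-ordered exponential of -i H: the strongly continuous family of
   unitaries that starts at the identity and solves the Schroedinger equation
   from a dense set of initial states.  Since H(t) is symmetric there is at most
   one such family; for a time-independent self-adjoint H it is exp(-iHt). *)
Definition evolution_operator (R : realType) (V : completeNormedModType R[i])
    (dot : {dot V for Num.conj}) (H : R -> partial_operator ('I_2 -> V))
    (U : R -> ('I_2 -> V) -> ('I_2 -> V)) : Prop :=
  [/\ forall psi, U 0 psi = psi,
      forall t : R, 0 <= t -> unitary dot (U t),
      forall psi a, {within `[0, +oo[, continuous (fun t => U t psi a)}
    & exists2 D : set ('I_2 -> V), dense2 D &
        forall psi, D psi -> forall t : R, 0 < t ->
          dom (H t) (U t psi) /\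
          forall a, (fun h : R => (h^-1)%:C *: (U (t + h) psi a - U t psi a)) @ 0^'
            --> - 'i%C *: act (H t) (U t psi) a].

Definition reduced_state (R : realType) (V : completeNormedModType R[i])
    (dot : {dot V for Num.conj}) (I : choiceType) (e : I -> V)
    (U : ('I_2 -> V) -> ('I_2 -> V)) (rhoS : 'M[R[i]]_2) (rhoB : V -> V) :
    'M[R[i]]_2 :=
  partial_trace dot e (fun psi => U (tensor rhoS rhoB (adjoint dot U psi))).

(* [T] is the transfer matrix of the map [Lambda] on qubit states. *)
Definition transfer_matrix (R : realType)
    (Lambda : 'M[R[i]]_2 -> 'M[R[i]]_2) (T : 'M[R]_4) : Prop :=
  forall (rho : 'M[R[i]]_2) (n : 'cV[R]_4),
    density_matrix rho -> bloch_vector rho n -> bloch_vector (Lambda rho) (T *m n).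

(* exp(-i \int_0^t H_Cl) for the noise history [h]; the values H_Cl(t') at
   different times commute, all being multiples of sigma_z. *)
Definition noise_evolution (R : realType) (B : R) (h : R -> R) (t : R) : 'M[R[i]]_2 :=
  expm ((- ('i%C / 2) *
         (\int[@lebesgue_measure R]_(x in `[0, t]) (- B + h x))%:C) *: sigma_z R).

(** * Phases *)

Definition coherence (R : realType) (c s : R) : R := Num.sqrt (c ^+ 2 + s ^+ 2).

Definition beta (R : realType) (c s : R) : R :=
  Num.sqrt (1 - coherence c s ^+ 2) / coherence c s.

(* [Phi] is the angle of the unit vector (x, y), followed continuously on
   [0, t] from Phi(0) = 0. *)
Definition continuous_angle (R : realType) (t : R) (x y Phi : R -> R) : Prop :=
  [/\ Phi 0 = 0, {within `[0, t], continuous Phi}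
    & forall u : R, 0 <= u <= t -> cos (Phi u) = x u /\ sin (Phi u) = y u].

Definition absolutely_continuous (R : realType) (a b : R) (f : R -> R) : Prop :=
  forall eps : R, 0 < eps -> exists2 delta : R, 0 < delta &
    forall (n : nat) (x y : 'I_n -> R),
      (forall i, [/\ a <= x i, x i <= y i & y i <= b]) ->
      (forall i j, i != j -> y i <= x j \/ y j <= x i) ->
      \sum_i (y i - x i) < delta ->
      \sum_i `|f (y i) - f (x i)| < eps.

(* A coupling that is bounded on ]0, t[ makes the phases Lipschitz.  For an
   unbounded one, c and s may be nowhere differentiable, and absolute continuity
   of the phases is exactly what gives a meaning to h_1 and h_2. *)
Definition bounded_on (R : realType) (V : completeNormedModType R[i])
    (X : R -> partial_operator V) (t : R) : Prop :=
  exists M : R, forall u : R, 0 < u < t ->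
    forall x, dom (X u) x -> `|act (X u) x| <= M%:C * `|x|.

(* [h] is meaningful as the derivative of [Phi], up to the constant B, on
   [0, t].  Everywhere differentiability is too much to ask: Phi_1 and Phi_2
   generically have a kink wherever r = 1. *)
Definition noise_history (R : realType) (t : R) (Phi h : R -> R) : Prop :=
  {ae @lebesgue_measure R, forall x, 0 <= x <= t -> derivable Phi x 1} /\
  (@lebesgue_measure R).-integrable `[0, t] (EFin \o h).

(* Main.v *)
(** Dephasing makes the total evolution diagonal, U = diag(U_0, U_1), so the bath
    multiplies the coherence of the qubit by W = Tr(U_0 rho_B U_1^-1) = c - i s,
    a number of the closed unit disc with |W| = r.  Such a number is the midpoint
    of the two points (1 + i beta) W and (1 - i beta) W of the unit circle, whose
    arguments are -Phi_1 and -Phi_2, while a classical history with integral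
    Phi_k multiplies the coherence by exp(-i Phi_k).
    It remains to see that h_k is integrable with integral Phi_k.  For a bounded
    coupling, U_1^-1 U_0 is Lipschitz in time, hence so are W, sqrt(1 - r^2) (a
    distance to a line in a Hilbert space), beta and the phases.  Absolutely
    continuous functions satisfy the fundamental theorem of calculus: reduce to
    nondecreasing ones by total variation, and apply the Radon-Nikodym theorem to
    their Lebesgue-Stieltjes measure. *)

(* Three obstacles shape the proof. The bath may have an uncountable basis, and the operator whose
   trace is W is not positive, so even the convergence of the trace needs an argument. Writing rho_B
   as a sum of rank one operators |w_k><w_k| whose squared norms sum to 1 turns the trace into the
   basis-free series of the inner products of U_0 w_k and U_1 w_k, on which all estimates on W are
   made. H may be unbounded and depend on time, so there is no exponential series to manipulate, and
   U is differentiable only from a dense set of initial states. Everything about U is drawn from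
   derivatives of inner products of components of two evolved states. Symmetry removes H_B, and what
   remains carries the difference of two eigenvalues of sigma_z: with equal eigenvalues the product
   is constant, which makes U diagonal; with different ones a bound on H_SB alone makes it
   Lipschitz. The square root of 1 - r^2 has infinite slope in r at r = 1, so a Lipschitz W does not
   by itself give Lipschitz phases; hence the geometric reading of this root. *)
Require Import Defs.
From HB Require Import structures.
From mathcomp Require Import all_boot all_order all_algebra finmap.
From mathcomp Require Import sesquilinear complex.
From mathcomp Require Import all_classical all_reals all_analysis.
From mathcomp Require Import measurable_realfun ring lra.
From mathcomp.analysis.showcase Require summability.
Import Order.TTheory GRing.Theory Num.Theory.
Import numFieldNormedType.Exports.
Set Implicit Arguments.
Unset Strict Implicit.
Unset Printing Implicit Defensive.
Local Open Scope classical_set_scope.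
Local Open Scope complex_scope.
Local Open Scope ring_scope.

(** * Absolutely continuous functions *)

Section absolute_continuity.
Context {R : realType}.
Implicit Types (a b : R) (f : R -> R).
Local Notation TV := total_variation.

Definition nonoverlapping (T : finType) a b (x y : T -> R) : Prop :=
  (forall i, [/\ a <= x i, x i <= y i & y i <= b]) /\
  (forall i j, i != j -> y i <= x j \/ y j <= x i).

(** Subdivided families are most naturally indexed by pairs, hence the general finite index type. *)
Lemma absolutely_continuous_finType a b f (eps : R) :
  absolutely_continuous a b f -> 0 < eps -> exists2 delta : R, 0 < delta &
  forall (T : finType) (x y : T -> R), nonoverlapping a b x y ->
    \sum_i (y i - x i) < delta -> \sum_i `|f (y i) - f (x i)| < eps.
Proof.
move=> acf eps0; have [delta delta0 H] := acf _ eps0.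
exists delta => // T x y [xy dis].
have sumE (F : T -> R) : \sum_i F i = \sum_(i < #|T|) F (enum_val i).
  by rewrite -big_enum_val.
rewrite !sumE => /(H #|T| (x \o enum_val) (y \o enum_val)); apply => //=.
by move=> i j ij; apply: dis; rewrite (inj_eq enum_val_inj).
Qed.

(** Subdividing the intervals changes neither their total length nor the fact that they do not
    overlap, so the subintervals are again an admissible family. *)
Lemma absolutely_continuous_variation a b f (eps : R) :
  absolutely_continuous a b f -> 0 < eps -> exists2 delta : R, 0 < delta &
  forall (T : finType) (x y : T -> R), nonoverlapping a b x y ->
    \sum_i (y i - x i) < delta ->
    forall s : T -> seq R, (forall i, itv_partition (x i) (y i) (s i)) ->
    \sum_i variation (x i) (y i) f (s i) < eps.
Proof.
move=> acf eps0; have [delta delta0 H] := absolutely_continuous_finType acf eps0.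
exists delta => // T x y [xy dis] sumd s ps.
(* [p i] stays at [y i] after the last point of [s i]. All subdivisions thus have the same number
   [N] of steps, the extra ones being degenerate. *)
pose p i k := nth (y i) (x i :: s i) k.
pose N := \max_i size (s i).
have psize i k : (size (s i) <= k)%N -> p i k = y i.
  rewrite leq_eqVlt => /predU1P[<-|sk].
    by rewrite /p (itv_partition_nth_size _ (ps i)).
  by rewrite /p nth_default.
have pN i : p i N = y i by rewrite psize// /N (leq_bigmax (F := fun i => size (s i))).
have ple i k : p i k <= p i k.+1.
  have [ks|sk] := ltnP k (size (s i)); last by rewrite !psize// ltnW.
  by have [+ _] := ps i => /(pathP (y i))/(_ _ ks)/ltW.
have pmono i : {homo p i : m n / (m <= n)%N >-> m <= n}.
  by apply: homo_leq => //; [exact: le_trans].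
have pge i k : x i <= p i k by rewrite (le_trans _ (pmono i 0%N k _)).
have pley i k : p i k <= y i.
  by rewrite -(psize i (maxn k (size (s i)))) ?leq_maxr// pmono// leq_maxl.
have -> : \sum_i variation (x i) (y i) f (s i) =
    \sum_(q : T * 'I_N) `|f (p q.1 q.2.+1) - f (p q.1 q.2)|.
  rewrite -(pair_bigA _ (fun i (k : 'I_N) => `|f (p i k.+1) - f (p i k)|))/=.
  apply: eq_bigr => i _; rewrite /variation.
  rewrite -(big_mkord xpredT (fun k => `|f (p i k.+1) - f (p i k)|)).
  rewrite [RHS](@big_cat_nat _ _ _ (size (s i)))//=; last first.
    by rewrite /N (leq_bigmax (F := fun i => size (s i))).
  rewrite [X in _ = _ + X]big_nat_cond [X in _ = _ + X]big1 ?addr0//.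
  move=> k /andP[/andP[sk _] _].
  by rewrite !psize ?subrr ?normr0// ltnW.
apply: (H _ (fun q : T * 'I_N => p q.1 q.2) (fun q => p q.1 q.2.+1)).
- split => [[i k]/=|[i k] [j l]/=].
  + have [? ? ?] := xy i; split => //; last exact: le_trans (pley _ _) _.
    exact: le_trans (pge _ _).
  + rewrite xpair_eqE negb_and; have [<-{j}|ij _] := eqVneq i j.
      move=> /= kl; have /orP[kl'|lk] := leq_total k l.
        by left; apply: pmono; rewrite ltn_neqAle kl kl'.
      by right; apply: pmono; rewrite ltn_neqAle lk eq_sym kl.
    have [?|?] := dis _ _ ij; [left|right].
      exact: le_trans (pley _ _) (le_trans _ (pge _ _)).
    exact: le_trans (pley _ _) (le_trans _ (pge _ _)).
- rewrite (le_lt_trans _ sumd)//.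
  rewrite -(pair_bigA _ (fun i (k : 'I_N) => p i k.+1 - p i k))/=.
  apply: ler_sum => i _.
  rewrite -(big_mkord xpredT (fun k => p i k.+1 - p i k)).
  by rewrite telescope_sumr// pN.
Qed.

(** A mesh below the [delta] belonging to 1 cuts the interval into finitely many pieces of variation
    at most 1, and variation is additive. *)
Lemma absolutely_continuous_bounded_variation a b f : a <= b ->
  absolutely_continuous a b f -> bounded_variation a b f.
Proof.
move=> ab acf.
have [delta delta0 H] := absolutely_continuous_variation acf ltr01.
have small x y : a <= x -> x <= y -> y <= b -> y - x < delta ->
    TV x y f \is a fin_num.
  move=> ax xy yb xyd; apply/bounded_variationP => //; exists 1 => _ [s ps <-].
  have := H unit (fun=> x) (fun=> y) _ _ (fun=> s) (fun=> ps).
  rewrite !big_const !card_unit/= !addr0 => /(_ _ xyd)/ltW; apply.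
  by split => // -[] [].
have [n nd] : exists n : nat, (b - a) / n.+1%:R < delta.
  exists (Num.bound ((b - a) / delta)).
  rewrite ltr_pdivrMr// mulrC -ltr_pdivrMr//.
  apply: (lt_le_trans (archi_boundP _)); last by rewrite ler_nat.
  by rewrite divr_ge0// ?subr_ge0// ltW.
pose h := (b - a) / n.+1%:R; rewrite -/h in nd.
have h0 : 0 <= h by rewrite divr_ge0// subr_ge0.
have hb k : (k <= n.+1)%N -> a + k%:R * h <= b.
  move=> kn; rewrite -lerBrDl /h mulrA ler_pdivrMr// mulrC ler_wpM2l ?subr_ge0//.
  by rewrite ler_nat.
have hE : a + n.+1%:R * h = b by rewrite /h mulrC divfK ?pnatr_eq0// addrC subrK.
clearbody h.
apply/bounded_variationP => //.
suff P k : (k <= n.+1)%N -> TV a (a + k%:R * h) f \is a fin_num.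
  by have := P _ (leqnn n.+1); rewrite hE.
elim: k => [_|k ih kn]; first by rewrite mul0r addr0 total_variationxx.
rewrite (@total_variationD _ a _ (a + k%:R * h)) ?lerDl ?mulr_ge0//; last first.
  by rewrite lerD2l ler_wpM2r// ler_nat.
rewrite fin_numD ih ?(ltnW kn)//=; apply: small.
- by rewrite lerDl mulr_ge0.
- by rewrite lerD2l ler_wpM2r// ler_nat.
- exact: hb.
- by rewrite -addn1 natrD mulrDl mul1r addrA [X in X < _](_ : _ = h)//; ring.
Qed.

(** An increment of the total variation is the variation over that interval, and nearly optimal
    partitions of all the intervals together fall under [absolutely_continuous_variation]. *)
Lemma absolutely_continuous_total_variation a b f : a <= b ->
  absolutely_continuous a b f ->
  absolutely_continuous a b (fun x => fine (TV a x f)).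
Proof.
move=> ab acf eps eps0; have e20 : 0 < eps / 2 by rewrite divr_gt0.
have bvf := absolutely_continuous_bounded_variation ab acf.
have [delta delta0 H] := absolutely_continuous_variation acf e20.
exists delta => // n x y xy dis sumd.
have TVfin u v : a <= u -> u <= v -> v <= b -> TV u v f \is a fin_num.
  move=> au uv vb; apply/bounded_variationP => //.
  by apply: (bounded_variationl uv vb); apply: (bounded_variationr au (le_trans uv vb)).
have dTV i : fine (TV a (y i) f) - fine (TV a (x i) f) = fine (TV (x i) (y i) f).
  have [ax xy' yb] := xy i.
  rewrite (total_variationD _ ax xy') fineD ?TVfin//; first by rewrite addrC addKr.
  exact: le_trans yb.
(* The [n] errors add up to at most [eps / 2]; [n.+1] avoids a division by zero for the empty
   family. *)
have approx i : {s | itv_partition (x i) (y i) s &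
    fine (TV (x i) (y i) f) - eps / (2 * n.+1%:R) <= variation (x i) (y i) f s}.
  have [ax xy' yb] := xy i; apply: cid2.
  have e' : 0 < eps / (2 * n.+1%:R) by rewrite divr_gt0// mulr_gt0.
  have [_ [_ [s ps <-] <-] hs] := @ub_ereal_sup_adherent _ [set x%:E | x in variations (x i) (y i) f]
     _ e' (TVfin _ _ ax xy' yb).
  exists s => //; rewrite -lee_fin EFinB fineK ?TVfin//; exact/ltW.
have := H _ x y (conj xy dis) sumd (fun i => s2val (approx i))
  (fun i => s2valP (approx i)) => {}H.
apply: (@le_lt_trans _ _ (\sum_i (variation (x i) (y i) f (s2val (approx i)) +
    eps / (2 * n.+1%:R)))).
  apply: ler_sum => i _; have [ax xy' yb] := xy i.
  rewrite dTV ger0_norm ?fine_ge0 ?total_variation_ge0//.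
  by rewrite -lerBlDr; exact: s2valP' (approx i).
rewrite big_split/= [ltRHS]splitr ltr_leD// sumr_const card_ord.
rewrite invfM mulrA -mulrnAr ler_piMr// ?(ltW e20)// -mulr_natr mulrC.
by rewrite ler_pdivrMr// mul1r ler_nat.
Qed.

Lemma absolutely_continuousB a b f g :
  absolutely_continuous a b f -> absolutely_continuous a b g ->
  absolutely_continuous a b (f \- g).
Proof.
move=> acf acg eps eps0; have e20 : 0 < eps / 2 by rewrite divr_gt0.
have [d1 d10 H1] := acf _ e20; have [d2 d20 H2] := acg _ e20.
exists (Num.min d1 d2) => [|n x y xy dis]; first by rewrite lt_min d10.
rewrite lt_min => /andP[s1 s2].
rewrite [ltRHS]splitr (le_lt_trans _ (ltrD (H1 _ _ _ xy dis s1) (H2 _ _ _ xy dis s2)))//.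
rewrite -big_split/=; apply: ler_sum => i _.
rewrite (le_trans _ (ler_normB _ _))//.
by rewrite (_ : f (y i) - g (y i) - _ = f (y i) - f (x i) - (g (y i) - g (x i)))//; ring.
Qed.

(** Jordan decomposition: total variation minus (total variation minus [f]). *)
Lemma absolutely_continuous_nondecreasingB a b f : a <= b ->
  absolutely_continuous a b f -> exists F G : R -> R,
  [/\ f = F \- G, absolutely_continuous a b F, absolutely_continuous a b G,
      {in `[a, b] &, nondecreasing_fun F} & {in `[a, b] &, nondecreasing_fun G}].
Proof.
move=> ab acf; have acF := absolutely_continuous_total_variation ab acf.
have bvf := absolutely_continuous_bounded_variation ab acf.
have TVfin u v : a <= u -> u <= v -> v <= b -> TV u v f \is a fin_num.
  move=> au uv vb; apply/bounded_variationP => //.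
  by apply: (bounded_variationl uv vb); apply: (bounded_variationr au (le_trans uv vb)).
have ndF x y : a <= x -> x <= y -> y <= b ->
    `|f y - f x| <= fine (TV a y f) - fine (TV a x f).
  move=> ax xy yb.
  rewrite (total_variationD _ ax xy) fineD ?TVfin ?(le_trans xy)//.
  rewrite [leRHS]addrC addKr -lee_fin fineK ?TVfin//; exact: total_variation_ge.
exists (fun x => fine (TV a x f)), ((fun x => fine (TV a x f)) \- f); split => //.
- by apply/funext => x /=; rewrite subKr.
- exact: absolutely_continuousB.
- move=> x y; rewrite !in_itv/= => /andP[ax _] /andP[_ yb] xy.
  by rewrite -subr_ge0 (le_trans _ (ndF _ _ ax xy yb)).
- move=> x y; rewrite !in_itv/= => /andP[ax _] /andP[_ yb] xy.
  have := le_trans (ler_norm _) (ndF _ _ ax xy yb); rewrite /=; lra.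
Qed.

Lemma absolutely_continuous_uniform a b f (eps : R) :
  absolutely_continuous a b f -> 0 < eps -> exists2 delta : R, 0 < delta &
  forall x y, a <= x <= b -> a <= y <= b -> `|x - y| < delta -> `|f x - f y| < eps.
Proof.
move=> acf eps0; have [delta delta0 H] := acf _ eps0.
exists delta => // x y xab yab xyd.
wlog xy : x y xab yab xyd / x <= y.
  move=> W; have [|/ltW] := leP x y; first exact: W.
  by rewrite (distrC (f x)); apply: W => //; rewrite distrC.
have := H 1%N (fun=> x) (fun=> y); rewrite !big_ord1 (distrC (f x)); apply.
- by move: xab yab => /andP[? _] /andP[].
- by move=> i j; rewrite !ord1 eqxx.
- by rewrite -(ger0_norm (_ : 0 <= y - x)) ?subr_ge0// distrC.
Qed.

(** Extends the values on [a, b] by constants on both sides, so that notions requiring a function on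
    the whole line, such as [cumulative], apply. *)
Definition clamp a b f (x : R) := f (Num.max a (Num.min b x)).

Lemma clamp_id a b f x : a <= x <= b -> clamp a b f x = f x.
Proof. by move=> /andP[ax xb]; rewrite /clamp (min_idPr xb) (max_idPr ax). Qed.

Lemma clamp_itv a b (x : R) : a <= b -> a <= Num.max a (Num.min b x) <= b.
Proof. by move=> ab; rewrite le_max lexx/= ge_max ab ge_min lexx. Qed.

Lemma clamp_le a b (x y : R) : x <= y ->
  Num.max a (Num.min b x) <= Num.max a (Num.min b y).
Proof.
move=> xy; have [?|?] := leP b x; have [?|?] := leP b y; have [?|?] := leP a b;
  have [?|?] := leP a x; have [?|?] := leP a y; lra.
Qed.

Lemma clamp_dist a b (x y : R) :
  `|Num.max a (Num.min b x) - Num.max a (Num.min b y)| <= `|x - y|.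
Proof.
wlog xy : x y / x <= y.
  by move=> W; have [|/ltW] := leP x y; [exact: W|rewrite distrC (distrC x); exact: W].
rewrite !ler0_norm ?subr_le0 ?clamp_le//.
have [?|?] := leP b x; have [?|?] := leP b y; have [?|?] := leP a b;
  have [?|?] := leP a x; have [?|?] := leP a y; lra.
Qed.

Lemma clamp_absolutely_continuous a b f : a <= b ->
  absolutely_continuous a b f -> continuous (clamp a b f).
Proof.
move=> ab acf x; apply/cvgrPdist_lt => eps eps0.
have [d d0 H] := absolutely_continuous_uniform acf eps0.
near=> y; apply: H; [exact: clamp_itv..|].
by rewrite (le_lt_trans (clamp_dist _ _ _ _))//; near: y; exact: nbhs_dist_lt.
Unshelve. all: by end_near. Qed.

Lemma clamp_nondecreasing a b f : a <= b -> {in `[a, b] &, nondecreasing_fun f} ->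
  nondecreasing (clamp a b f).
Proof.
by move=> ab ndf x y xy; apply: ndf; rewrite ?in_itv/= ?clamp_itv ?clamp_le.
Qed.

Lemma lebesgue_stieltjes_measure_itvoc (G : cumulative R R) x y : x <= y ->
  lebesgue_stieltjes_measure G `]x, y]%classic = (G y - G x)%:E.
Proof.
move=> xy; rewrite /lebesgue_stieltjes_measure /measure_extension/=.
rewrite measurable_mu_extE; first exact: wlength_itv_bnd.
exact: is_ocitv.
Qed.

(** * Dyadic approximation of open sets *)

Section dyadic.
Context (a b : R) (ab : a < b) (U : set R) (oU : open U).

Let h n : R := (b - a) / (2 ^ n)%:R.
Let pt n k : R := a + k%:R * h n.
Let piece n k : set R := `]pt n k, pt n k.+1]%classic.
(* At each level only finitely many dyadic pieces lie in U, so that absolute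
   continuity, which is about finite families, applies to them. *)
Let inside n (k : 'I_(2 ^ n)) : bool := `[< piece n k `<=` U >].
Let approx n : set R := \bigcup_(k in [set` @inside n]) piece n k.

Let h_gt0 n : 0 < h n.
Proof. by rewrite divr_gt0 ?subr_gt0// ltr0n expn_gt0. Qed.

Let pt_le n : {homo pt n : k l / (k <= l)%N >-> k <= l}.
Proof. by move=> k l kl; rewrite lerD2l ler_pM2r// ler_nat. Qed.

Let pt0 n : pt n 0 = a. Proof. by rewrite /pt mul0r addr0. Qed.

Let pt_last n : pt n (2 ^ n) = b.
Proof.
rewrite /pt /h mulrC divfK; first by rewrite addrC subrK.
by rewrite pnatr_eq0 expn_eq0.
Qed.

Let ptS n k : pt n k.+1 - pt n k = h n.
Proof. by rewrite /pt -addn1 natrD; ring. Qed.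

Let pt_double n k : pt n.+1 k.*2 = pt n k.
Proof.
rewrite /pt /h expnS natrM -muln2 natrM.
have : (2 ^ n)%:R != 0 :> R by rewrite pnatr_eq0 expn_eq0.
by move: (2 ^ n)%:R => w w0; field.
Qed.

Let piece_cover n x : a < x <= b -> exists k : 'I_(2 ^ n), piece n k x.
Proof.
move=> /andP[ax xb].
have ex : exists k, x <= pt n k by exists (2 ^ n)%N; rewrite pt_last.
have [k xk kmin] := ex_minnP ex.
case: k => [|k] in xk kmin *; first by move: xk; rewrite pt0 leNgt ax.
have kn : (k < 2 ^ n)%N by apply: kmin; rewrite pt_last.
exists (Ordinal kn); rewrite /piece/= in_itv/= xk andbT ltNge.
by apply/negP => /kmin; rewrite ltnn.
Qed.

Let piece_disjoint n k l x : piece n k x -> piece n l x -> k = l.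
Proof.
rewrite /piece/= !in_itv/= => /andP[k1 k2] /andP[l1 l2].
apply/eqP; rewrite eqn_leq; apply/andP; split; rewrite leqNgt; apply/negP => kl.
  by have := lt_le_trans k1 (le_trans l2 (pt_le n kl)); rewrite ltxx.
by have := lt_le_trans l1 (le_trans k2 (pt_le n kl)); rewrite ltxx.
Qed.

Let approx_measure (G : cumulative R R) n : lebesgue_stieltjes_measure G (approx n) =
  (\sum_(k < 2 ^ n | inside k) (G (pt n k.+1) - G (pt n k)))%:E.
Proof.
rewrite /approx bigcup_pred measure_bigsetU_ord//=.
- rewrite -sumEFin; apply: eq_bigr => k _.
  by rewrite lebesgue_stieltjes_measure_itvoc// pt_le.
- by move=> i; exact: measurable_itv.
- move=> k l _ _ [x [kx lx]]; exact/ord_inj/(piece_disjoint kx lx).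
Qed.

(** The two halves of a piece inside [U] are pieces of the next level inside [U]. *)
Let approx_nondecreasing : {homo approx : n m / (n <= m)%N >-> (n <= m)%O}.
Proof.
apply/nondecreasing_seqP => n; apply/subsetPset => x [k /= /asboolP kU kx].
have sub i : piece n.+1 i x -> piece n.+1 i `<=` piece n k -> approx n.+1 x.
  move=> ix ik; have xab : a < x <= b.
    move: ix; rewrite /piece/= in_itv/= => /andP[x1 x2].
    move: kx; rewrite /piece/= in_itv/= => /andP[x3 x4].
    rewrite (le_lt_trans _ x3) -?(pt0 n) ?pt_le//=.
    by rewrite (le_trans x4)// -(pt_last n) pt_le.
  have [j jx] := piece_cover n.+1 xab.
  exists j => //=; rewrite /inside; apply/asboolP.
  by rewrite (piece_disjoint jx ix); exact: subset_trans ik kU.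
have halves : pt n k.+1 = pt n.+1 k.*2.+2 by rewrite -doubleS pt_double.
move: (kx); rewrite /piece/= in_itv/= => /andP[x1 x2].
have [xm|mx] := leP x (pt n.+1 k.*2.+1).
  apply: (sub k.*2); first by rewrite /piece/= in_itv/= pt_double x1 xm.
  move=> y; rewrite /piece/= !in_itv/= pt_double => /andP[-> ym]/=.
  by rewrite (le_trans ym)// halves pt_le.
apply: (sub k.*2.+1); first by rewrite /piece/= in_itv/= mx -halves.
move=> y; rewrite /piece/= !in_itv/= halves => /andP[ym ->]; rewrite andbT.
by rewrite (le_lt_trans _ ym)// -pt_double pt_le.
Qed.

Let approx_bigcup : \bigcup_n approx n = U `&` `]a, b]%classic.
Proof.
apply/seteqP; split=> [x [n _ [k /= /asboolP kU kx]]|x [Ux]].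
  split; first exact: kU.
  move: kx; rewrite /piece/= !in_itv/= => /andP[x1 x2].
  rewrite (le_lt_trans _ x1) -?(pt0 n) ?pt_le//=.
  by rewrite (le_trans x2)// -(pt_last n) pt_le.
rewrite /= in_itv/= => xab.
have /nbhs_ballP[e /= e0 xeU] : nbhs x U by exact: open_nbhs_nbhs.
have [n ne] : exists n, h n < e.
  exists (Num.bound ((b - a) / e)); rewrite /h ltr_pdivrMr ?ltr0n ?expn_gt0//.
  rewrite mulrC -ltr_pdivrMr//.
  apply: (lt_le_trans (archi_boundP _)); last by rewrite ler_nat ltnW// ltn_expl.
  by rewrite divr_ge0// ltW// subr_gt0.
have [k kx] := piece_cover n xab; exists n => //; exists k => //=.
apply/asboolP => y; move: kx; rewrite /piece/= !in_itv/= => /andP[x1 x2] /andP[y1 y2].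
apply: xeU; rewrite /ball/= (le_lt_trans _ ne)//.
by have := ptS n k; rewrite ler_norml; lra.
Qed.

(** The open set is the increasing union of the finite families [approx n]. The hypothesis bounds
    the measure of each of them, and continuity from below passes to the union. *)
Lemma lebesgue_stieltjes_measure_open_le (G : cumulative R R) (eps delta : R) :
  (forall (T : finType) (x y : T -> R), nonoverlapping a b x y ->
    \sum_i (y i - x i) < delta -> \sum_i `|G (y i) - G (x i)| < eps) ->
  (lebesgue_measure U < delta%:E)%E ->
  (lebesgue_stieltjes_measure G (U `&` `]a, b]%classic) <= eps%:E)%E.
Proof.
move=> H Ud; rewrite -approx_bigcup.
have mapprox n : measurable (approx n : set (measurableTypeR R)).
  by apply: fin_bigcup_measurable; [exact: finite_finset|move=> i _; exact: measurable_itv].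
have cvg := @nondecreasing_cvg_mu _ _ _ (lebesgue_stieltjes_measure G) approx mapprox
  (bigcupT_measurable _ mapprox) approx_nondecreasing.
rewrite -(cvg_lim _ cvg)//; apply: lime_le; first by apply/cvg_ex; eexists; exact: cvg.
apply: nearW => n /=; rewrite approx_measure lee_fin.
have subU : (lebesgue_measure (approx n) <= lebesgue_measure U)%E.
  apply: le_measure; rewrite ?inE//; first exact: open_measurable.
  by move=> x [k /= /asboolP]; apply.
(* Lebesgue measure is the Lebesgue-Stieltjes measure of the identity, so [approx_measure] computes
   it too. *)
have := le_lt_trans subU Ud; rewrite /lebesgue_measure approx_measure lte_fin => {}Ud.
(* A piece that is not inside [U] is replaced by the degenerate interval at [a], which contributes
   nothing to either sum. *)
pose x (k : 'I_(2 ^ n)) := if inside k then pt n k else a.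
pose y (k : 'I_(2 ^ n)) := if inside k then pt n k.+1 else a.
have -> : \sum_(k < 2 ^ n | inside k) (G (pt n k.+1) - G (pt n k)) =
    \sum_(k < 2 ^ n) `|G (y k) - G (x k)|.
  rewrite big_mkcond; apply: eq_bigr => k _; rewrite /x /y; case: ifP => _.
    by rewrite ger0_norm// subr_ge0 (cumulative_is_nondecreasing G)// pt_le.
  by rewrite subrr normr0.
apply/ltW/H; last first.
  rewrite (le_lt_trans _ Ud)// [leRHS]big_mkcond le_eqVlt; apply/orP; left.
  by apply/eqP/eq_bigr => k _; rewrite /x /y; case: ifP => //; rewrite subrr.
have age k : a <= pt n k by rewrite -(pt0 n) pt_le.
split=> [k|k l kl].
  rewrite /x /y; case: ifP => _; split => //; [exact: pt_le| |exact: ltW].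
  by rewrite -(pt_last n) pt_le.
rewrite /x /y; case: ifP => _; last by left; case: ifP.
case: ifP => _; last by right.
have [kl'|lk'|/ord_inj kl'] := ltngtP k l; last by rewrite kl' eqxx in kl.
- by left; exact: pt_le.
- by right; exact: pt_le.
Qed.
End dyadic.

Lemma nondecreasing_absolutely_continuous_integral a b f : a < b ->
  absolutely_continuous a b f -> {in `[a, b] &, nondecreasing_fun f} ->
  exists2 g : R -> R, (@lebesgue_measure R).-integrable setT (EFin \o g) &
  forall x, a <= x <= b -> f x = f a + (\int[lebesgue_measure]_(y in `[a, x]) g y)%R.
Proof.
move=> ab acf ndf.
have rc := right_continuousW (clamp_absolutely_continuous (ltW ab) acf).
have nd := clamp_nondecreasing (ltW ab) ndf.
pose G : cumulative R R := HB.pack (clamp a b f) (isCumulative.Build R _ R _ nd rc).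
pose nu0 := lebesgue_stieltjes_measure G.
have mab : measurable (`]a, b]%classic : set (measurableTypeR R)) by exact: measurable_itv.
have nuab : (nu0 `]a, b]%classic < +oo)%E.
  by rewrite /nu0 lebesgue_stieltjes_measure_itvoc ?ltry// ltW.
pose nu : {finite_measure set (measurableTypeR R) -> \bar R} := mfrestr mab nuab.
(* Outer regularity encloses a null set in an open set of measure below [delta], which the dyadic
   estimate handles. *)
have numu : nu `<< (@lebesgue_measure R).
  apply/null_content_dominatesP => A mA A0.
  apply/eqP; rewrite eq_le measure_ge0 andbT; apply/lee_addgt0Pr => eps eps0.
  rewrite add0e; have [delta delta0 H] := absolutely_continuous_finType acf eps0.
  have [|U [oU AU Ud]] := @lebesgue_regularity_outer _ A delta mA _ delta0.
    by rewrite A0 ltry.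
  have Ud' : (lebesgue_measure U < delta%:E)%E.
    rewrite -(setDUK AU) (le_lt_trans (measureU2 _ _ _))//.
      by apply: measurableD => //; exact: open_measurable.
    by rewrite A0 add0e.
  apply: (@le_trans _ _ (nu0 (U `&` `]a, b]%classic))).
    by apply: (@le_measure _ _ _ nu); rewrite ?inE//; exact: open_measurable.
  apply: (lebesgue_stieltjes_measure_open_le ab oU _ Ud') => T x y xy sxy.
  have := H T x y xy sxy; congr (_ < _); apply: eq_bigr => i _.
  have [+ _] := xy => /(_ i)[ax xyi yb]; rewrite /G/=.
  by rewrite !clamp_id ?ax ?yb ?(le_trans xyi) ?(le_trans _ xyi).
have [g [g0 gfin intg gE]] := radon_nikodym_sigma_finite numu.
exists (fine \o g).
  by apply: eq_integrable intg => // x _ /=; rewrite fineK.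
move=> x /andP[ax xb]; have := gE `]a, x]%classic (measurable_itv _).
rewrite [nu _](_ : _ = (f x - f a)%:E); last first.
  rewrite (_ : nu _ = nu0 (`]a, x] `&` `]a, b]))// setIidl; last first.
    by move=> y /=; rewrite !in_itv/= => /andP[-> /le_trans]; exact.
  rewrite /nu0 lebesgue_stieltjes_measure_itvoc// /G/=.
  by rewrite !clamp_id// ?ax ?lexx ?(ltW ab).
move=> E; apply/eqP; rewrite addrC -subr_eq; apply/eqP.
rewrite /Rintegral -integral_itv_obnd_cbnd; last first.
  apply: measurable_funTS; apply/measurable_EFinP/measurableT_comp => //.
  exact: measurable_int intg.
under eq_integral do rewrite /= fineK//.
by rewrite -E.
Qed.

Lemma absolutely_continuous_integral a b f : a < b -> absolutely_continuous a b f ->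
  exists2 g : R -> R, (@lebesgue_measure R).-integrable setT (EFin \o g) &
  forall x, a <= x <= b -> f x = f a + (\int[lebesgue_measure]_(y in `[a, x]) g y)%R.
Proof.
move=> ab acf; have [F [G [-> acF acG ndF ndG]]] := absolutely_continuous_nondecreasingB (ltW ab) acf.
have [g1 ig1 g1E] := nondecreasing_absolutely_continuous_integral ab acF ndF.
have [g2 ig2 g2E] := nondecreasing_absolutely_continuous_integral ab acG ndG.
exists (g1 \- g2).
  by apply: eq_integrable (integrableB _ ig1 ig2).
move=> x axb; rewrite /= g1E// g2E// RintegralB//=.
- ring.
- by apply: integrableS ig1.
- by apply: integrableS ig2.
Qed.

(** Lebesgue differentiation of the indefinite integral, which coincides with [f] near every
    interior point. *)
Lemma absolutely_continuous_derivable_ae a b f g : a < b ->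
  (@lebesgue_measure R).-integrable setT (EFin \o g) ->
  (forall x, a <= x <= b -> f x = f a + (\int[lebesgue_measure]_(y in `[a, x]) g y)%R) ->
  {ae @lebesgue_measure R, forall x, a <= x <= b -> derivable f x 1 /\ derive1 f x = g x}.
Proof.
move=> ab ig fE.
(* Nothing is known of [f] outside [a, b], so both end points go into the exceptional null set. *)
have ae_ne (c : R) : {ae @lebesgue_measure R, forall x, x != c}.
  exists [set c]; split; [exact: measurable_set1|exact: lebesgue_measure_set1|].
  by move=> x /= /negP; rewrite negbK => /eqP.
have := @FTC1 R g (BLeft a) _ _.
have igS D : measurable D -> (@lebesgue_measure R).-integrable D (EFin \o g).
  by move=> mD; exact: integrableS ig.
have locg : locally_integrable setT g.
  by apply: open_integrable_locally => //; exact: openT.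
move=> /(_ (fun=> igS _ (measurable_itv _)) locg) H.
have aef := ae_filter_ringOfSetsType (@lebesgue_measure R).
apply: filterS3 H (ae_ne a) (ae_ne b) => x Hx xa xb /andP[ax bx].
have {}ax : a < x by rewrite lt_neqAle eq_sym xa ax.
have {}bx : x < b by rewrite lt_neqAle xb bx.
have [dF F'] := Hx ax.
pose F y := (f a + \int[lebesgue_measure]_(t in `[a, y]) g t)%R.
have near_f : {near x, F =1 f}.
  near=> y; rewrite /F -fE//; apply/andP; split; apply/ltW; near: y.
    exact: lt_nbhsr.
  exact: lt_nbhsl.
have isF : is_derive x 1 F (g x).
  rewrite -F' -[X in is_derive _ _ _ X]add0r.
  apply: is_deriveD; rewrite derive1E; exact: derivableP.
have dFx : derivable F x 1 by exact: ex_derive.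
split; first exact: (near_eq_derivable near_f dFx).
by rewrite derive1E -(near_eq_derive _ near_f) ?oner_neq0// derive_val.
Unshelve. all: by end_near. Qed.

(** * Measurability of the derivative and the fundamental theorem of calculus *)

Lemma exists_invn_lt (eps : R) : 0 < eps -> exists k : nat, k.+1%:R^-1 < eps.
Proof.
move=> eps0; exists (Num.bound eps^-1); rewrite invf_plt ?posrE//.
by rewrite (lt_le_trans (archi_boundP _)) ?ler_nat// invr_ge0 ltW.
Qed.

(** By the Cauchy criterion, the set [E] of points of differentiability is a countable combination
    of the sets [C k m]; each of these is closed, which makes the uncountable intersection over
    pairs of increments harmless. On [E] the derivative is the limit of a sequence of continuous
    difference quotients. *)
Lemma measurable_derive1 f : continuous f ->
  measurable_fun setT (derive1 f : R -> R).
Proof.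
move=> cf; pose q h (x : R) : R := h^-1 *: (f (h + x) - f x).
have qc h : continuous (q h).
  move=> x; apply: cvgZr; apply: cvgB; last exact: cf.
  apply: continuous_comp; last exact: cf.
  by apply: cvgD; [exact: cvg_cst|exact: cvg_id].
pose small (m : nat) (h : R) : Prop := h != 0 /\ `|h| < m.+1%:R^-1.
pose C k m : set R := \bigcap_(p in [set p : R * R | small m p.1 /\ small m p.2])
  [set x | `|q p.1 x - q p.2 x| <= k.+1%:R^-1].
have mC k m : measurable (C k m).
  apply: closed_measurable; apply: closed_bigI => -[h1 h2] _ /=.
  apply: (@preimage_closed _ _ (fun x => `|q h1 x - q h2 x|) [set y | y <= k.+1%:R^-1]);
    last exact: closed_le.
  move=> x _; apply: (@continuous_comp _ _ _ (fun x => q h1 x - q h2 x) Num.norm).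
    by apply: continuousB; exact: qc.
  exact: norm_continuous.
pose E : set R := \bigcap_k \bigcup_m C k m.
have mE : measurable E by apply: bigcapT_measurable => k; exact: bigcupT_measurable.
have EP x : E x <-> cvg (q h x @[h --> 0^']).
  split=> [Ex|].
    apply/cauchy_cvgP/cauchy_exP => eps eps0.
    have [k ke] := exists_invn_lt eps0.
    have [m _ Cx] := Ex k I.
    pose h0 : R := (2 * m.+1%:R)^-1.
    have h00 : 0 < h0 by rewrite invr_gt0 mulr_gt0.
    exists (q h0 x).
    suff : \forall h \near 0^', ball (q h0 x) eps (q h x) by [].
    near=> h; rewrite /ball/= (le_lt_trans _ ke)//.
    apply: (Cx (h0, h)); split; split => //=.
    - by rewrite gt_eqF.
    - by rewrite gtr0_norm// ltf_pV2 ?posrE ?mulr_gt0// ltr_pMl// ltr1n.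
    - by near: h; exact: nbhs_dnbhs_neq.
    - near: h; apply: dnbhs0_lt; rewrite invr_gt0//.
  move=> /cauchy_cvgP/cauchyP cx k _.
  have [|l] := cx (2 * k.+1%:R)^-1; first by rewrite invr_gt0 mulr_gt0.
  rewrite /fmap/= => -[e /= e0 eh].
  have [m me] := exists_invn_lt e0.
  exists m => // -[h1 h2] [/= [h10 h1m] [h20 h2m]].
  have B h : h != 0 -> `|h| < m.+1%:R^-1 -> `|l - q h x| < (2 * k.+1%:R)^-1.
    by move=> h0 hm; apply: (eh h) => //=; rewrite sub0r normrN (lt_trans hm).
  rewrite (le_trans (ler_distD l _ _))// (distrC _ l).
  have -> : k.+1%:R^-1 = (2 * k.+1%:R)^-1 + (2 * k.+1%:R)^-1 :> R.
    have : k.+1%:R != 0 :> R by rewrite pnatr_eq0.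
    by move: k.+1%:R => w w0; field.
  by rewrite lerD// ltW// B.
apply: (@measurable_fun_cvg _ _ _ _ (fun n => (fun x => q n.+1%:R^-1 x * \1_E x))).
  move=> n; apply: measurable_funM; last exact: measurable_indic.
  exact: continuous_measurable_fun.
move=> x _; have [Ex|nEx] := pselect (E x); last first.
  (* Without a derivative, [derive1] takes the default value 0, which the indicator of [E]
     reproduces. *)
  rewrite (_ : derive1 f x = 0).
    by rewrite indicE memNset//; under eq_fun do rewrite mulr0; exact: cvg_cst.
  by rewrite /derive1 dvgP// => /EP.
rewrite indicE mem_set//; under eq_fun do rewrite mulr1.
have /cvg_ex [l ql] := (EP x).1 Ex.
rewrite (_ : derive1 f x = l); last exact: cvg_lim ql.
apply/cvgrPdist_lt => eps eps0; move/cvgrPdist_lt : ql => /(_ _ eps0)[e /= e0 eh].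
have [m me] := exists_invn_lt e0; exists m => // n /= mn.
apply: eh => /=; last by rewrite invr_eq0 pnatr_eq0.
rewrite sub0r normrN gtr0_norm// (le_lt_trans _ me)//.
by rewrite lef_pV2 ?posrE// ler_nat.
Unshelve. all: by end_near. Qed.

Lemma near_eq_derive1 f g x : {near x, f =1 g} -> derive1 f x = derive1 g x.
Proof. by move=> fg; rewrite !derive1E; exact: near_eq_derive. Qed.

(** [derive1 f] at an end point depends on [f] outside the interval, but two points do not affect
    measurability. In the interior the clamped function has the same derivative. *)
Lemma measurable_derive1_itv a b f : absolutely_continuous a b f ->
  measurable_fun `[a, b] (derive1 f : R -> R).
Proof.
move=> acf; apply: (@measurable_fun_itv_cc _ _ _ false true).
have [ab|ba] := leP a b; last first.
  by rewrite set_itv_ge ?bnd_simp -?leNgt ?ltW//; exact: measurable_fun_set0.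
have mc := measurable_derive1 (clamp_absolutely_continuous ab acf).
apply: eq_measurable_fun (measurable_funTS mc) => x.
rewrite inE/= in_itv/= => /andP[ax xb].
apply: near_eq_derive1; near=> y; apply: clamp_id.
by apply/andP; split; apply: ltW; near: y; [exact: lt_nbhsr|exact: lt_nbhsl].
Unshelve. all: by end_near. Qed.

(** The Radon-Nikodym density is traded for [derive1 f], which agrees with it almost everywhere; the
    exchange under the integral rests on the measurability of [derive1 f]. *)
Lemma absolutely_continuous_FTC a b f : a <= b -> absolutely_continuous a b f ->
  [/\ {ae @lebesgue_measure R, forall x, a <= x <= b -> derivable f x 1},
      (@lebesgue_measure R).-integrable `[a, b] (EFin \o derive1 f) &
      (\int[lebesgue_measure]_(x in `[a, b]) derive1 f x)%R = f b - f a].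
Proof.
move=> /[swap] acf; have mf := measurable_derive1_itv acf.
rewrite le_eqVlt => /predU1P[ab|ab].
  rewrite -{}ab in acf mf *; split.
  - exists [set a]; split; [exact: measurable_set1|exact: lebesgue_measure_set1|].
    move=> x /= nd; apply/eqP; rewrite eq_le; apply: contrapT => xa; apply: nd => /andP[x1 x2].
    by exfalso; apply: xa; rewrite x1 x2.
  - apply/integrableP; split; first exact/measurable_EFinP.
    by rewrite set_itv1 integral_set1.
  - by rewrite subrr /Rintegral set_itv1 integral_set1.
have [g ig fE] := absolutely_continuous_integral ab acf.
have ae := absolutely_continuous_derivable_ae ab ig fE.
have aef := ae_filter_ringOfSetsType (@lebesgue_measure R).
have igt : (@lebesgue_measure R).-integrable `[a, b] (EFin \o g) by exact: integrableS ig.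
have mEf : measurable_fun `[a, b] (EFin \o derive1 f) by exact/measurable_EFinP.
have mEg := measurable_int _ igt.
have aeE : ae_eq lebesgue_measure `[a, b]%classic (EFin \o derive1 f) (EFin \o g).
  by apply: filterS ae => x H; rewrite /= in_itv/= => /H[_ ->].
split => //.
- by apply: filterS ae => x H /H[].
- apply/integrableP; split => //; move/integrableP: igt => -[_]; apply: le_lt_trans.
  rewrite le_eqVlt; apply/orP; left; apply/eqP; apply: ge0_ae_eq_integral => //.
  + exact: measurableT_comp.
  + exact: measurableT_comp.
  + by apply: filterS aeE => x H xab; rewrite H.
- rewrite fE ?(ltW ab) ?lexx// [RHS]addrC addKr.
  rewrite /Rintegral; congr fine.
  exact: (@ae_eq_integral _ _ _ (@lebesgue_measure R) _ _ _ (measurable_itv _) mEf mEg aeE).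
Qed.

End absolute_continuity.

(** * Positive operators on a Hilbert space *)

Section real_norm.
Context {R : realType}.
Implicit Types (W : normedZmodType R[i]) (U : normedModType R[i]).

(* The norm of V takes its values in R[i]; [nr] is the same number in R. *)
Definition nr W (x : W) : R := complex.Re `|x|.

Lemma ge0_ReE (z : R[i]) : 0 <= z -> z = (complex.Re z)%:C.
Proof. by move=> /ger0_real/RRe_real. Qed.

Lemma nrE W (x : W) : `|x| = (nr x)%:C.
Proof. exact: ge0_ReE. Qed.

Lemma nr_ge0 W (x : W) : 0 <= nr x.
Proof. by rewrite -lecR -nrE normr_ge0. Qed.

Lemma nr0 W : nr (0 : W) = 0. Proof. by rewrite /nr normr0. Qed.

Lemma nr0_eq0 W (x : W) : nr x = 0 -> x = 0.
Proof. by move=> x0; apply/normr0_eq0; rewrite nrE x0. Qed.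

Lemma nrN W (x : W) : nr (- x) = nr x. Proof. by rewrite /nr normrN. Qed.

Lemma nrB W (x y : W) : nr (x - y) = nr (y - x).
Proof. by rewrite -nrN opprB. Qed.

Lemma nrD W (x y : W) : nr (x + y) <= nr x + nr y.
Proof. by rewrite -lecR rmorphD/= -!nrE ler_normD. Qed.

Lemma nr_sum W I (r : seq I) (P : pred I) (F : I -> W) :
  nr (\sum_(i <- r | P i) F i) <= \sum_(i <- r | P i) nr (F i).
Proof.
elim/big_ind2 : _ => //; first by rewrite nr0.
by move=> x1 x2 y1 y2 h1 h2; rewrite (le_trans (nrD _ _))// lerD.
Qed.

Lemma nrZ U (a : R[i]) (x : U) : nr (a *: x) = nr a * nr x.
Proof.
by apply: (@complexI R); rewrite rmorphM/= -!nrE normrZ.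
Qed.

Lemma nrM (a b : R[i]) : nr (a * b) = nr a * nr b.
Proof. by apply: (@complexI R); rewrite rmorphM/= -!nrE normrM. Qed.

Lemma nr_sqr (z : R[i]) : nr z ^+ 2 = complex.Re z ^+ 2 + complex.Im z ^+ 2.
Proof. by apply: (@complexI R); rewrite rmorphXn/= -nrE -add_Re2_Im2. Qed.

Lemma nrC (x : R) : nr (x%:C) = `|x|.
Proof.
apply/eqP; rewrite -(eqrXn2 (n := 2))// ?nr_ge0//.
by rewrite nr_sqr/= expr0n addr0 real_normK ?num_real.
Qed.

Lemma conjcE (z : R[i]) : z^* = conjc z.
Proof. by []. Qed.

Lemma nr_conj (z : R[i]) : nr (z^*) = nr z.
Proof. by apply: (@complexI R); rewrite -!nrE norm_conjC. Qed.

Lemma mul_conj (z : R[i]) : z * z^* = (nr z ^+ 2)%:C.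
Proof. by rewrite rmorphXn/= -nrE normCK. Qed.

Lemma Re_le_nr (z : R[i]) : `|complex.Re z| <= nr z.
Proof. by rewrite -lecR -nrE; exact: normc_ge_Re. Qed.

Lemma Im_le_nr (z : R[i]) : `|complex.Im z| <= nr z.
Proof.
rewrite -(@ler_pXn2r _ 2) ?nnegrE ?nr_ge0// nr_sqr real_normK ?num_real// lerDr.
exact: sqr_ge0.
Qed.

Lemma ReB (x y : R[i]) : complex.Re (x - y) = complex.Re x - complex.Re y.
Proof. by case: x y => [? ?] [? ?]. Qed.

Lemma ReD (x y : R[i]) : complex.Re (x + y) = complex.Re x + complex.Re y.
Proof. by case: x y => [? ?] [? ?]. Qed.

Lemma ReZ (a : R) (z : R[i]) : complex.Re (a%:C * z) = a * complex.Re z.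
Proof. by case: z => x y /=; rewrite mul0r subr0. Qed.

Lemma Re_conj (z : R[i]) : complex.Re (z^*) = complex.Re z.
Proof. by case: z. Qed.

Lemma Re_sum I (r : seq I) (P : pred I) (F : I -> R[i]) :
  complex.Re (\sum_(i <- r | P i) F i) = \sum_(i <- r | P i) complex.Re (F i).
Proof. by elim/big_ind2 : _ => // x1 x2 y1 y2 <- <-; rewrite ReD. Qed.

Lemma cvg_nrP {U} {T} {F : set_system T} {FF : Filter F} (f : T -> U) (l : U) :
  f @ F --> l <-> forall e : R, 0 < e -> \forall x \near F, nr (l - f x) < e.
Proof.
split=> [/cvgrPdist_lt fl e e0|H].
  have e0' : 0 < e%:C by rewrite ltcR.
  by near=> x; rewrite -ltcR -nrE; near: x; exact: fl.
apply/cvgrPdist_lt => e e0; have eE := ge0_ReE (ltW e0).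
have /H : 0 < complex.Re e by rewrite -ltcR -eE.
by apply: filterS => x; rewrite -ltcR -nrE -eE.
Unshelve. all: by end_near. Qed.

Lemma cvg_realcomplex {T} {F : set_system T} {FF : Filter F} (f : T -> R) (l : R) :
  f @ F --> l -> (fun x => (f x)%:C : R[i]^o) @ F --> (l%:C : R[i]^o).
Proof.
move=> /cvgrPdist_lt fl; apply/cvg_nrP => e /fl.
by apply: filterS => x; rewrite -nrC rmorphB.
Qed.

Lemma cvg_Re {T} {F : set_system T} {FF : Filter F} (f : T -> R[i]^o) (l : R[i]^o) :
  f @ F --> l -> (fun x => complex.Re (f x)) @ F --> complex.Re l.
Proof.
move=> /cvg_nrP fl; apply/cvgrPdist_lt => e /fl.
by apply: filterS => x; apply: le_lt_trans; rewrite -ReB Re_le_nr.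
Qed.

Lemma cvg_nr {U} {T} {F : set_system T} {FF : Filter F} (f : T -> U) (l : U) :
  f @ F --> l -> (fun x => nr (f x)) @ F --> nr l.
Proof.
move=> /cvg_nrP fl; apply/cvgrPdist_lt => e /fl.
apply: filterS => x; apply: le_lt_trans.
have := nrD (l - f x) (f x); rewrite subrK => h1.
have := nrD (f x - l) l; rewrite subrK nrB => h2.
by rewrite ler_norml; lra.
Qed.

End real_norm.

(** * Positive sesquilinear forms *)

Section positive_forms.
Context {R : realType} {E : lmodType R[i]}.

Record positive_form (q : E -> E -> R[i]) : Prop := PositiveForm {
  form_linear : forall a x y z, q (a *: x + y) z = a * q x z + q y z;
  form_conj : forall x y, q y x = (q x y)^*;
  form_ge0 : forall x, 0 <= q x x }.

Context (q : E -> E -> R[i]) (qP : positive_form q).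
Let Q x := complex.Re (q x x).

Lemma quad_ge0 x : 0 <= Q x.
Proof. by have := form_ge0 qP x; rewrite lecE => /andP[_]. Qed.

Lemma quadE x : q x x = (Q x)%:C.
Proof. exact/ge0_ReE/(form_ge0 qP). Qed.

Lemma posform0l z : q 0 z = 0.
Proof. by have := form_linear qP (-1) 0 0 z; rewrite scaler0 addr0 mulN1r addNr. Qed.

Lemma posformDl x y z : q (x + y) z = q x z + q y z.
Proof. by have := form_linear qP 1 x y z; rewrite scale1r mul1r. Qed.

Lemma posformZl a x z : q (a *: x) z = a * q x z.
Proof. by have := form_linear qP a x 0 z; rewrite addr0 posform0l addr0. Qed.

Lemma posform0r z : q z 0 = 0.
Proof. by rewrite (form_conj qP) posform0l rmorph0. Qed.

Lemma posformDr x y z : q z (x + y) = q z x + q z y.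
Proof. by rewrite (form_conj qP) posformDl rmorphD/= -!(form_conj qP). Qed.

Lemma posformZr a x z : q z (a *: x) = a^* * q z x.
Proof. by rewrite (form_conj qP) posformZl rmorphM/= -!(form_conj qP). Qed.

Lemma form_suml I (r : seq I) (P : pred I) (F : I -> E) z :
  q (\sum_(i <- r | P i) F i) z = \sum_(i <- r | P i) q (F i) z.
Proof.
by elim/big_ind2 : _ => //; [exact: posform0l|move=> ? ? ? ? <- <-; exact: posformDl].
Qed.

Lemma form_sumr I (r : seq I) (P : pred I) (F : I -> E) z :
  q z (\sum_(i <- r | P i) F i) = \sum_(i <- r | P i) q z (F i).
Proof.
by elim/big_ind2 : _ => //; [exact: posform0r|move=> ? ? ? ? <- <-; exact: posformDr].
Qed.

Lemma quadDZ (a : R[i]) x y :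
  Q (x + a *: y) = Q x + 2 * complex.Re (a^* * q x y) + nr a ^+ 2 * Q y.
Proof.
rewrite /Q posformDl !posformDr !posformZl !posformZr !ReD.
have -> : a * q y x = (a^* * q x y)^* by rewrite rmorphM/= conjCK -(form_conj qP).
by rewrite mulrA mul_conj ReZ Re_conj; ring.
Qed.

(** Positivity at [x - t q(x, y) y] for every real [t], then [t = 1 / Q y]. The form may be
    degenerate, so [Q y = 0] is a case of its own. *)
Lemma form_cauchy_schwarz x y : nr (q x y) ^+ 2 <= Q x * Q y.
Proof.
have H (t : R) : 0 <= Q x - 2 * t * nr (q x y) ^+ 2 + t ^+ 2 * nr (q x y) ^+ 2 * Q y.
  have := quad_ge0 (x + ((- t)%:C * q x y) *: y); rewrite quadDZ.
  rewrite nrM nrC normrN exprMn real_normK ?num_real//.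
  rewrite rmorphM/= -mulrA [(q x y)^* * _]mulrC mul_conj conjcE conjc_real ReZ/=.
  lra.
have x0 := quad_ge0 x; have y0 := quad_ge0 y.
have z0 := sqr_ge0 (nr (q x y)).
move: (Q x) (Q y) (nr (q x y) ^+ 2) x0 y0 z0 H => A C B A0 C0 B0 H.
have [C00|Cn0] := eqVneq C 0.
  rewrite C00 mulr0 leNgt; apply/negP => B1.
  (* For [C = 0] the inequality is affine in [t], and this value makes its right-hand side -1. *)
  have := H ((A + 1) / (2 * B)); rewrite C00 mulr0 addr0.
  rewrite (_ : 2 * _ * B = A + 1); last by field; rewrite gt_eqF.
  lra.
have {}C0 : 0 < C by rewrite lt_neqAle eq_sym Cn0.
have := H C^-1; rewrite (_ : _ + _ = A - B / C); last by field.
by rewrite subr_ge0 ler_pdivrMr.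
Qed.

Lemma quad_eq0_form x y : Q x = 0 -> q x y = 0.
Proof.
move=> x0; apply: nr0_eq0; apply/eqP; rewrite -sqrf_eq0 eq_le sqr_ge0 andbT.
by rewrite (le_trans (form_cauchy_schwarz _ _))// x0 mul0r.
Qed.

(** By the parallelogram law the two sides differ by [Q (x - y)]. It serves as a triangle inequality
    without square roots. *)
Lemma quadD_le x y : Q (x + y) <= 2 * Q x + 2 * Q y.
Proof.
have := quad_ge0 (x + (-1) *: y); have := quadDZ 1 x y; have := quadDZ (-1) x y.
rewrite scale1r scaleN1r rmorphN1 conjC1 mul1r mulN1r nrN.
rewrite (_ : nr 1 = 1) ?expr1n; last by rewrite /nr normr1.
rewrite (_ : complex.Re (- q x y) = - complex.Re (q x y)); last by case: (q x y).
lra.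
Qed.

Lemma quadZ (a : R[i]) x : Q (a *: x) = nr a ^+ 2 * Q x.
Proof. by rewrite /Q posformZl posformZr mulrA mul_conj ReZ. Qed.

End positive_forms.

Lemma cvg_sumr {K : numFieldType} {U : normedModType K} {T} {F : set_system T}
    {FF : Filter F} {J} (r : seq J) (P : pred J) (f : J -> T -> U) (l : J -> U) :
  (forall j, f j @ F --> l j) ->
  (fun x => \sum_(j <- r | P j) f j x) @ F --> \sum_(j <- r | P j) l j.
Proof.
move=> fl; elim: r => [|j r ih].
  by rewrite big_nil; under eq_fun do rewrite big_nil; exact: cvg_cst.
rewrite big_cons; under eq_fun do rewrite big_cons.
by case: (P j) => //; apply: cvgD.
Qed.

(** * Unconditional sums *)

Section partial_sums.
Context {I : choiceType}.
Local Notation psum := summability.partial_sum.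
Local Notation totally := summability.totally.

#[local] Instance totally_properfilter : ProperFilter (@totally I) :=
  summability.totally_filter.

Lemma partial_sumE (W : zmodType) (F : I -> W) (J : {fset I}) : psum F J = \sum_(j <- J) F j.
Proof. by rewrite big_seq_fsetE. Qed.

Lemma partial_sum_le (R : numDomainType) (F : I -> R) (A B : {fset I}) :
  (forall j, 0 <= F j) -> (A `<=` B)%fset -> psum F A <= psum F B.
Proof.
move=> F0 AB; rewrite !partial_sumE (big_fsetID _ (mem A) B)/=.
have -> : [fset x in B | x \in A]%fset = A.
  by apply/fsetP => x; rewrite !inE/= andbC; case: (boolP (x \in A)) => //= /(fsubsetP AB) ->.
by rewrite lerDl sumr_ge0.
Qed.

Lemma near_totally (A : {fset I}) : \forall J \near totally, (A `<=` J)%fset.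
Proof. by exists A. Qed.

Lemma partial_sum_le_lim (R : realType) (F : I -> R) (A : {fset I}) l :
  (forall j, 0 <= F j) -> psum F @ totally --> l -> psum F A <= l.
Proof.
move=> F0 Fl; rewrite -(cvg_lim _ Fl)//; apply: limr_ge; first by apply/cvg_ex; exists l.
by apply: filterS (near_totally A) => J; exact: partial_sum_le.
Qed.

End partial_sums.
#[export] Existing Instance totally_properfilter.

(** * Inner product, continuity and polarization *)

Section hilbert.
Context {R : realType} {V : completeNormedModType R[i]} {dot : {dot V for Num.conj}}.
Context (hV : hilbert_space dot).

Lemma dot_form : positive_form (fun x y => dot x y).
Proof.
split => [a x y z|x y|x].
- by rewrite linearPl.
- by rewrite hermC/= expr0 mul1r.
- by rewrite -hV exprn_ge0.
Qed.

Lemma Re_dot x : complex.Re (dot x x) = nr x ^+ 2.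
Proof. by apply: (@complexI R); rewrite -(quadE dot_form) -hV nrE rmorphXn. Qed.

Lemma dotE x : dot x x = (nr x ^+ 2)%:C.
Proof. by rewrite (quadE dot_form) Re_dot. Qed.

Lemma dot_conj x y : dot y x = (dot x y)^*.
Proof. exact: (form_conj dot_form). Qed.

Lemma nr_dot_le x y : nr (dot x y) <= nr x * nr y.
Proof.
rewrite -(@ler_pXn2r _ 2) ?nnegrE ?mulr_ge0 ?nr_ge0// exprMn -!Re_dot.
exact: (form_cauchy_schwarz dot_form).
Qed.

Lemma dot_eq0 x : (forall y, dot x y = 0) -> x = 0.
Proof.
move=> x0; apply: nr0_eq0; apply/eqP; rewrite -sqrf_eq0 -Re_dot.
by rewrite x0.
Qed.

Lemma cvg_dot {T} {F : set_system T} {FF : Filter F} (f g : T -> V) (x y : V) :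
  f @ F --> x -> g @ F --> y ->
  (fun t => dot (f t) (g t) : R[i]^o) @ F --> (dot x y : R[i]^o).
Proof.
move=> fx gy; apply/cvg_nrP => e e0.
have e1 : 0 < e / (nr x + nr y + 1 + 1).
  by rewrite divr_gt0// ltr_wpDl ?addr_ge0 ?nr_ge0.
have /(_ _ e1) fxe := (@cvg_nrP R V T F FF f x).1 fx.
have gyn := (@cvg_nrP R V T F FF g y).1 gy.
apply: filterS3 (gyn _ ltr01) (gyn _ e1) fxe => t gt1 gte fte.
have -> : dot x y - dot (f t) (g t) = dot (x - f t) (g t) + dot x (y - g t).
  by rewrite linearBl linearBr/=; ring.
have gtn : nr (g t) <= nr y + 1.
  have := nrD (g t - y) y; rewrite subrK nrB => h; lra.
rewrite (le_lt_trans (nrD _ _))//.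
have h1 := nr_dot_le (x - f t) (g t); have h2 := nr_dot_le x (y - g t).
have x0 := nr_ge0 x; have y0 := nr_ge0 y.
set d := e / _ in fte gte.
have h3 : nr (x - f t) * nr (g t) <= d * (nr y + 1).
  by apply: ler_pM; rewrite ?nr_ge0// ltW.
have h4 : nr x * nr (y - g t) <= nr x * d by rewrite ler_wpM2l// ltW.
have h5 : d * (nr x + nr y + 1 + 1) = e.
  by rewrite /d divfK// gt_eqF// ltr_wpDl ?addr_ge0.
have d0 : 0 < d by [].
lra.
Qed.

Lemma nrBZ_sqr (a : R[i]) x y :
  nr (x + a *: y) ^+ 2 = nr x ^+ 2 + 2 * complex.Re (a^* * dot x y) + nr a ^+ 2 * nr y ^+ 2.
Proof. by rewrite -!Re_dot (quadDZ dot_form). Qed.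

Definition iunit (m : nat) : R[i] := 'i%C ^+ m.

Lemma nr_iunit m : nr (iunit m) = 1.
Proof.
have i1 : nr ('i%C : R[i]) = 1.
  by apply/eqP; rewrite -(eqrXn2 (n := 2))// ?nr_ge0// nr_sqr/= expr0n add0r.
by elim: m => [|m ih]; rewrite /iunit ?expr0 ?exprS ?nrM ?ih ?i1 ?mulr1// /nr normr1.
Qed.

Lemma conj_i : ('i%C : R[i])^* = - 'i%C.
Proof. by apply/eqP; rewrite eq_complex/= oppr0 !eqxx. Qed.

(** Polarization writes products as combinations of squared norms, so that interchanging two
    summations has to be justified for nonnegative terms only. *)
Lemma complex_polarization (a b : R[i]) :
  a * b^* = 4^-1 * \sum_(m < 4) iunit m * (nr (a + iunit m * b) ^+ 2)%:C.
Proof.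
rewrite -[LHS](mulKf (_ : (4 : R[i]) != 0)) ?pnatr_eq0//; congr (_ * _).
rewrite !big_ord_recr big_ord0/= add0r -!mul_conj !rmorphD !rmorphM/= /iunit !exprS expr0.
rewrite !rmorphM/= conj_i rmorph1.
have ii : ('i%C : R[i]) * 'i%C = -1 by rewrite -expr2 sqr_i.
by move: a^* b^* ('i%C) ii => ca cb i ii; ring: ii.
Qed.

Lemma dot_polarization x y :
  dot x y = 4^-1 * \sum_(m < 4) iunit m * (nr (x + iunit m *: y) ^+ 2)%:C.
Proof.
rewrite -[LHS](mulKf (_ : (4 : R[i]) != 0)) ?pnatr_eq0//; congr (_ * _).
rewrite !big_ord_recr big_ord0/= add0r -!dotE.
rewrite !(posformDl dot_form) !(posformDr dot_form) !(posformZl dot_form) !(posformZr dot_form).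
rewrite /iunit !exprS expr0 !rmorphM/= conj_i rmorph1.
have ii : ('i%C : R[i]) * 'i%C = -1 by rewrite -expr2 sqr_i.
by move: (dot x y) (dot x x) (dot y y) (dot y x) ('i%C) ii => xy xx yy yx i ii; ring: ii.
Qed.

(** * Orthonormal bases and double sums *)

Section orthonormal.
Context {I : choiceType} (e : I -> V).
Context (he : orthonormal_basis dot e).
Local Notation psum := summability.partial_sum.
Local Notation totally := summability.totally.

(** Pythagoras: the partial sum is the orthogonal projection of [x] onto the span of the chosen
    basis vectors. *)
Lemma nr_sub_partial_sum (J : {fset I}) x :
  nr (x - psum (fun j => dot x (e j) *: e j) J) ^+ 2 =
  nr x ^+ 2 - psum (fun j => nr (dot x (e j)) ^+ 2) J.
Proof.
set p := psum _ J.
have px : dot p x = (psum (fun j => nr (dot x (e j)) ^+ 2) J)%:C.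
  rewrite /p /summability.partial_sum (form_suml dot_form) rmorph_sum/=.
  by apply: eq_bigr => i _; rewrite linearZl_LR/= (dot_conj x) mul_conj.
have pp : dot p p = (psum (fun j => nr (dot x (e j)) ^+ 2) J)%:C.
  rewrite -px {1 3}/p /summability.partial_sum !(form_suml dot_form).
  apply: eq_bigr => i _; rewrite !linearZl_LR/=; congr (_ * _).
  rewrite /p /summability.partial_sum (form_sumr dot_form) (bigD1 i)//= big1 ?addr0.
    by rewrite (posformZr dot_form) he.1 eqxx mulr1 -dot_conj.
  move=> k ki; rewrite (posformZr dot_form) he.1 [_ == _]negbTE ?mulr0//.
  by rewrite eq_sym.
have xp : dot x p = dot p x by rewrite dot_conj px conjcE conjc_real.
apply: (@complexI R); rewrite -dotE linearBl !linearBr/= xp px pp dotE.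
by rewrite subrr subr0 rmorphB.
Qed.

Lemma bessel (J : {fset I}) x : psum (fun j => nr (dot x (e j)) ^+ 2) J <= nr x ^+ 2.
Proof. by rewrite -subr_ge0 -nr_sub_partial_sum sqr_ge0. Qed.

Lemma parseval x :
  psum (fun j => nr (dot x (e j)) ^+ 2) @ totally --> nr x ^+ 2.
Proof.
have -> : psum (fun j => nr (dot x (e j)) ^+ 2) =
    (fun J => nr x ^+ 2 - nr (x - psum (fun j => dot x (e j) *: e j) J) ^+ 2).
  by apply/funext => J; rewrite nr_sub_partial_sum subKr.
have h : (fun J => nr (x - psum (fun j => dot x (e j) *: e j) J)) @ totally --> (0 : R).
  rewrite -(@nr0 _ V) -(subrr x); apply: cvg_nr; apply: cvgB; first exact: cvg_cst.
  exact: he.2.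
rewrite -[X in _ --> X]subr0; apply: cvgB; first exact: cvg_cst.
rewrite -(mulr0 (0 : R)); under eq_fun do rewrite expr2; exact: cvgM.
Qed.

(** Tonelli for the array of squared coefficients: its sum by rows is [S] by Parseval, and its
    column sums [F] have the same total. *)
Lemma sum_nr_dot_sqr (z : nat -> V) (S : R) :
  (fun n => \sum_(k < n) nr (z k) ^+ 2) @ \oo --> S ->
  exists F : I -> R,
    (forall j, (fun n => \sum_(k < n) nr (dot (z k) (e j)) ^+ 2) @ \oo --> F j) /\
    psum F @ totally --> S.
Proof.
move=> zS; pose u j n := \sum_(k < n) nr (dot (z k) (e j)) ^+ 2.
have psum_u J n : psum (fun j => u j n) J = \sum_(k < n) psum (fun j => nr (dot (z k) (e j)) ^+ 2) J.
  by rewrite /summability.partial_sum /u exchange_big.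
have nr1 x j : nr (dot x (e j)) ^+ 2 <= nr x ^+ 2.
  by have := bessel [fset j]%fset x; rewrite partial_sumE big_seq_fset1.
have ndz : nondecreasing_seq (fun n => \sum_(k < n) nr (z k) ^+ 2).
  by apply/nondecreasing_seqP => n; rewrite big_ord_recr/= lerDl sqr_ge0.
have cz : cvgn (fun n => \sum_(k < n) nr (z k) ^+ 2) by apply/cvg_ex; exists S.
have leS n : \sum_(k < n) nr (z k) ^+ 2 <= S.
  by rewrite -(cvg_lim _ zS)//; exact: (nondecreasing_cvgn_le ndz cz n).
have ndu j : nondecreasing_seq (u j).
  by apply/nondecreasing_seqP => n; rewrite /u big_ord_recr/= lerDl sqr_ge0.
have cu j : cvgn (u j).
  apply: nondecreasing_is_cvgn => //; exists S => _ [n _ <-].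
  by rewrite (le_trans _ (leS n))// ler_sum.
exists (fun j => limn (u j)); split => //.
have uF j n : u j n <= limn (u j) by exact: nondecreasing_cvgn_le.
have FS J : psum (fun j => limn (u j)) J <= S.
  have h : (fun n => psum (fun j => u j n) J) @ \oo --> psum (fun j => limn (u j)) J.
    rewrite /summability.partial_sum.
    by apply: (cvg_sumr (f := fun (j : J) n => u (val j) n)) => j; exact: cu.
  rewrite -(cvg_lim _ h)//; apply: limr_le; first by apply/cvg_ex; eexists; exact: h.
  apply: nearW => n; rewrite psum_u (le_trans _ (leS n))// ler_sum// => k _.
  exact: bessel.
apply/cvgrPdist_lt => eps eps0.
have e20 : 0 < eps / 2 by rewrite divr_gt0.
(* Finitely many [z k] carry [S] up to [eps / 2], and Parseval for these finitely many vectors loses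
   at most another [eps / 2] on a large finite set of indices. *)
move/cvgrPdist_lt : (zS) => /(_ _ e20)[n _ /(_ n (leqnn n)) nS].
have hn : (fun J => psum (fun j => u j n) J) @ totally --> \sum_(k < n) nr (z k) ^+ 2.
  under eq_fun do rewrite psum_u.
  apply: (cvg_sumr (f := fun (k : 'I_n) J => psum (fun j => nr (dot (z k) (e j)) ^+ 2) J)) => k.
  exact: parseval.
move/cvgrPdist_lt : hn => /(_ _ e20); apply: filterS => J hJ; rewrite ger0_norm ?subr_ge0//.
have h : psum (fun j => u j n) J <= psum (fun j => limn (u j)) J.
  by rewrite !partial_sumE ler_sum.
move: hJ nS; rewrite !ltr_norml; lra.
Qed.

Lemma cvg_sum_nr_sqr (x y : nat -> V) (Sx Sy : R) (a : R[i]) : nr a = 1 ->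
  (fun n => \sum_(k < n) nr (x k) ^+ 2) @ \oo --> Sx ->
  (fun n => \sum_(k < n) nr (y k) ^+ 2) @ \oo --> Sy ->
  cvgn (fun n => \sum_(k < n) nr (x k + a *: y k) ^+ 2).
Proof.
have nd (z : nat -> V) : nondecreasing_seq (fun n => \sum_(k < n) nr (z k) ^+ 2).
  by apply/nondecreasing_seqP => n; rewrite big_ord_recr/= lerDl sqr_ge0.
have leS (z : nat -> V) S : (fun n => \sum_(k < n) nr (z k) ^+ 2) @ \oo --> S ->
    forall n, \sum_(k < n) nr (z k) ^+ 2 <= S.
  move=> zS n; have cz : cvgn (fun n => \sum_(k < n) nr (z k) ^+ 2) by apply/cvg_ex; exists S.
  by rewrite -(cvg_lim _ zS)//; exact: (nondecreasing_cvgn_le (nd z) cz n).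
move=> a1 /leS xS /leS yS.
apply: nondecreasing_is_cvgn; first exact: (nd (fun k => x k + a *: y k)).
exists (2 * Sx + 2 * Sy) => _ [n _ <-].
rewrite (le_trans _ (lerD (ler_wpM2l _ (xS n)) (ler_wpM2l _ (yS n))))//.
rewrite !mulr_sumr -big_split/= ler_sum// => k _.
have := quadD_le dot_form (x k) (a *: y k).
by rewrite (quadZ dot_form) !Re_dot a1 expr1n mul1r.
Qed.

Lemma cvg_complexM {T} {F : set_system T} {FF : Filter F} (a : R[i]) (f : T -> R[i]) (l : R[i]) :
  (f : T -> R[i]^o) @ F --> (l : R[i]^o) ->
  ((fun t => a * f t) : T -> R[i]^o) @ F --> (a * l : R[i]^o).
Proof. by move=> fl; exact: (@cvgZr _ R[i]^o _ _ _ a f l). Qed.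

(** The trace of the sum of the rank one operators |x_k><y_k|, computed in the basis [e], is a
    number [W] in which the basis does not occur. *)
Lemma sum_dot_dot (x y : nat -> V) (Sx Sy : R) :
  (fun n => \sum_(k < n) nr (x k) ^+ 2) @ \oo --> Sx ->
  (fun n => \sum_(k < n) nr (y k) ^+ 2) @ \oo --> Sy ->
  exists W : R[i], ((fun n => \sum_(k < n) dot (x k) (y k)) : nat -> R[i]^o) @ \oo --> (W : R[i]^o) /\
  exists2 F : I -> R[i],
    (forall j, ((fun n => \sum_(k < n) dot (x k) (e j) * dot (e j) (y k)) : nat -> R[i]^o)
       @ \oo --> (F j : R[i]^o)) &
    (psum F : _ -> R[i]^o) @ totally --> (W : R[i]^o).
Proof.
move=> xS yS.
pose z m k := x k + iunit m *: y k.
have cz m : cvgn (fun n => \sum_(k < n) nr (z m k) ^+ 2).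
  exact: cvg_sum_nr_sqr (nr_iunit m) xS yS.
pose S m := limn (fun n => \sum_(k < n) nr (z m k) ^+ 2).
have zS m : (fun n => \sum_(k < n) nr (z m k) ^+ 2) @ \oo --> S m by exact: cz.
pose F m := sval (cid (sum_nr_dot_sqr (zS m))).
have HF m := svalP (cid (sum_nr_dot_sqr (zS m))).
exists (4^-1 * \sum_(m < 4) iunit m * (S m)%:C); split.
  rewrite [X in X @ _ --> _](_ : _ = fun n => 4^-1 * \sum_(m < 4) iunit m * (\sum_(k < n) nr (z m k) ^+ 2)%:C); last first.
    apply/funext => n; under eq_bigr do rewrite dot_polarization.
    rewrite -mulr_sumr exchange_big/=; congr (_ * _); apply: eq_bigr => m _.
    by rewrite rmorph_sum/= mulr_sumr.
  apply: cvg_complexM; apply: (@cvg_sumr _ R[i]^o) => m; apply: cvg_complexM.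
  exact: cvg_realcomplex (zS m).
exists (fun j => 4^-1 * \sum_(m < 4) iunit m * (F m j)%:C) => [j|].
  rewrite [X in X @ _ --> _](_ : _ = fun n => 4^-1 * \sum_(m < 4) iunit m * (\sum_(k < n) nr (dot (z m k) (e j)) ^+ 2)%:C); last first.
    apply/funext => n; under eq_bigr do rewrite (dot_conj _ (e j)) complex_polarization.
    rewrite -mulr_sumr exchange_big/=; congr (_ * _); apply: eq_bigr => m _.
    rewrite rmorph_sum/= mulr_sumr; apply: eq_bigr => k _.
    by rewrite /z (posformDl dot_form) (posformZl dot_form).
  apply: cvg_complexM; apply: (@cvg_sumr _ R[i]^o) => m; apply: cvg_complexM.
  exact: cvg_realcomplex ((HF m).1 j).
rewrite [X in X @ _ --> _](_ : _ = fun J => 4^-1 * \sum_(m < 4) iunit m * (psum (F m) J)%:C); last first.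
  apply/funext => J; rewrite /summability.partial_sum -mulr_sumr exchange_big/=.
  by congr (_ * _); apply: eq_bigr => m _; rewrite rmorph_sum/= mulr_sumr.
apply: cvg_complexM; apply: (@cvg_sumr _ R[i]^o) => m; apply: cvg_complexM.
exact: cvg_realcomplex (HF m).2.
Qed.

End orthonormal.

(** * Positive operators and Cholesky elimination *)

Definition positive_operator (A : V -> V) :=
  linear A /\ forall x, 0 <= dot (A x) x.

(** Over the complex numbers positivity forces symmetry: the quadratic form is real at [x + y] and
    at [x + i y], which fixes the imaginary and the real part of the required identity. *)
Lemma positive_operator_form A : positive_operator A ->
  positive_form (fun x y => dot (A x) y).
Proof.
move=> [linA A0].
have lq a x y z : dot (A (a *: x + y)) z = a * dot (A x) z + dot (A y) z.
  by rewrite linA linearPl.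
split => // x y.
have lD u v z : dot (A (u + v)) z = dot (A u) z + dot (A v) z.
  by have := lq 1 u v z; rewrite scale1r mul1r.
have l0 z : dot (A 0) z = 0 by have := lq (-1) 0 0 z; rewrite scaler0 addr0 mulN1r addNr.
have lZ a u z : dot (A (a *: u)) z = a * dot (A u) z.
  by have := lq a u 0 z; rewrite !addr0 l0 addr0.
have xx := ger0_Im (A0 x); have yy := ger0_Im (A0 y).
have := ger0_Im (A0 (x + y)); have := ger0_Im (A0 (x + 'i%C *: y)).
rewrite !lD !linearDr/= !lZ !linearZr_LR/=.
move: xx yy; move: (dot (A x) x) (dot (A y) y) (dot (A x) y) (dot (A y) x).
move=> [a1 a2] [b1 b2] [c1 c2] [d1 d2] /= -> ->.
move=> h1 h2; apply/eqP; rewrite eq_complex/=.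
by apply/andP; split; apply/eqP; lra.
Qed.

(** The Schur complement of [A] along [u]: it subtracts the rank one operator of the vector
    [pivot A u]. When [dot (A u) u] is 0, positivity gives [A u = 0], and the default value of the
    division by zero is harmless. *)
Definition deflate (A : V -> V) (u : V) (x : V) : V :=
  A x - (dot (A x) u / dot (A u) u) *: A u.

Definition pivot (A : V -> V) (u : V) : V :=
  (Num.sqrt (complex.Re (dot (A u) u)))^-1%:C *: A u.

Section deflation.
Context (A : V -> V) (u : V).
Context (hA : positive_operator A).
Let qA := positive_operator_form hA.

Lemma deflate_dot x y :
  dot (deflate A u x) y = dot (A x) y - dot x (pivot A u) * dot (pivot A u) y.
Proof.
rewrite /deflate /pivot linearBl/= !(posformZl dot_form) (posformZr dot_form).
have -> : dot x (A u) = dot (A x) u by rewrite dot_conj (form_conj qA x u) conjCK.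
rewrite (quadE qA) conjcE conjc_real; congr (_ - _).
have r0 := quad_ge0 qA u; move: (complex.Re _) r0 => r r0.
rewrite -(sqr_sqrtr r0) sqrtr_sqr ger0_norm ?sqrtr_ge0//.
by rewrite fmorphV rmorphXn/= -exprVn; ring.
Qed.

(** Positivity of the remainder is the Cauchy-Schwarz inequality for the form of [A]. *)
Lemma positive_operator_deflate : positive_operator (deflate A u).
Proof.
have [linA A0] := hA; split=> [a x y|x].
  rewrite /deflate linA (form_linear dot_form) scalerBr scalerA.
  by rewrite mulrDl scalerDl -mulrA opprD addrACA.
rewrite deflate_dot [dot (pivot A u) x]dot_conj mul_conj (quadE qA) -rmorphB ler0c.
rewrite /pivot (posformZr dot_form) nrM nr_conj exprMn.
have -> : dot x (A u) = dot (A x) u by rewrite dot_conj (form_conj qA x u) conjCK.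
have r0 := quad_ge0 qA u; have cs := form_cauchy_schwarz qA x u.
have x0 := quad_ge0 qA x.
move: (complex.Re (dot (A u) u)) (complex.Re (dot (A x) x)) r0 x0 cs => r q r0 q0 cs.
rewrite subr_ge0 nrC ger0_norm ?invr_ge0 ?sqrtr_ge0// exprVn sqr_sqrtr//.
have [->|rn0] := eqVneq r 0; first by rewrite invr0 mul0r.
by rewrite mulrC ler_pdivrMr// lt_neqAle eq_sym rn0.
Qed.

Lemma deflate_self : deflate A u u = 0.
Proof.
rewrite /deflate; have [h|h] := eqVneq (complex.Re (dot (A u) u)) 0.
  have -> : A u = 0 by apply: dot_eq0 => y; exact: (quad_eq0_form qA).
  by rewrite scaler0 subrr.
rewrite divff ?scale1r ?subrr// (quadE qA).
by apply: contra_neq h => h; apply: (@complexI R); rewrite h.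
Qed.

Lemma deflate_eq0 x : A x = 0 -> deflate A u x = 0.
Proof. by move=> Ax; rewrite /deflate Ax linear0l mul0r scale0r subrr. Qed.

End deflation.

(* Cholesky elimination replaces the spectral theorem: it writes A as a sum of
   rank one positive operators, up to a positive remainder that vanishes on the
   vectors already used. *)
Fixpoint cholesky (A : V -> V) (u : nat -> V) n : V -> V :=
  if n is m.+1 then deflate (cholesky A u m) (u m) else A.

Definition cholesky_vector A u n := pivot (cholesky A u n) (u n).

Section cholesky.
Context (A : V -> V) (u : nat -> V).
Context (hA : positive_operator A).

Lemma cholesky_positive n : positive_operator (cholesky A u n).
Proof. by elim: n => //= n; exact: positive_operator_deflate. Qed.

Lemma cholesky_dot n x y :
  dot (A x) y = \sum_(k < n) dot x (cholesky_vector A u k) * dot (cholesky_vector A u k) y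
                + dot (cholesky A u n x) y.
Proof.
elim: n => [|n ih]; first by rewrite big_ord0 add0r.
rewrite big_ord_recr/= (deflate_dot (u n) (cholesky_positive n)) ih -/(cholesky_vector A u n).
by ring.
Qed.

Lemma cholesky_eq0 k n : (k < n)%N -> cholesky A u n (u k) = 0.
Proof.
elim: n => // n ih; rewrite ltnS leq_eqVlt => /predU1P[->|/ih kn]/=.
  exact: deflate_self (cholesky_positive n).
exact: deflate_eq0.
Qed.

Lemma cholesky_quad n x : complex.Re (dot (A x) x) =
  \sum_(k < n) nr (dot (cholesky_vector A u k) x) ^+ 2 + complex.Re (dot (cholesky A u n x) x).
Proof.
rewrite (cholesky_dot n) ReD Re_sum; congr (_ + _); apply: eq_bigr => k _.
by rewrite (dot_conj _ x) mulrC mul_conj.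
Qed.

Lemma cholesky_quad_le n x : complex.Re (dot (cholesky A u n x) x) <= complex.Re (dot (A x) x).
Proof. by rewrite (cholesky_quad n) lerDr sumr_ge0// => k _; rewrite sqr_ge0. Qed.

End cholesky.

(** * Density operators as sums of rank one operators *)

Section density.
Context {I : choiceType} (e : I -> V) (rho : V -> V).
Context (he : orthonormal_basis dot e).
Context (hrho : density_operator dot e rho).
Local Notation psum := summability.partial_sum.
Local Notation totally := summability.totally.

Lemma density_positive : positive_operator rho.
Proof. by have [l _ p _] := hrho. Qed.

Let p j := complex.Re (dot (rho (e j)) (e j)).

Let p_ge0 j : 0 <= p j.
Proof. exact: (quad_ge0 (positive_operator_form density_positive)). Qed.

Let psum_p : psum p @ totally --> (1 : R).
Proof.
have [_ _ _ h] := hrho.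
rewrite (_ : psum p = fun J => complex.Re (psum (fun j => dot (rho (e j)) (e j)) J)).
  exact: cvg_Re h.
by apply/funext => J; rewrite /summability.partial_sum Re_sum.
Qed.

(** Only countably many diagonal entries are nonzero, since their sum converges: the finite set
    [A n] leaves out less than [1 / n.+1] of the trace, and pairs (set, position) enumerate the
    union of these sets. *)
Lemma density_support : exists s : nat -> I, forall j, p j != 0 -> exists k, s k = j.
Proof.
have near1 n : exists A : {fset I}, forall J, (A `<=` J)%fset -> `|1 - psum p J| < n.+1%:R^-1.
  have n0 : (0 : R) < n.+1%:R^-1 by rewrite invr_gt0.
  by move/cvgrPdist_lt : psum_p => /(_ _ n0)[A _ hA]; exists A.
pose A n := sval (cid (near1 n)).
have hA n : forall J, (A n `<=` J)%fset -> `|1 - psum p J| < n.+1%:R^-1 := svalP (cid (near1 n)).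
have [j0] : exists j : I, True.
  apply: contrapT => noI; have := hA 0%N (A 0%N) (fsubset_refl _).
  rewrite partial_sumE big1_seq ?subr0 ?normr1 ?invr1 ?ltxx// => j _.
  by exfalso; apply: noI; exists j.
move=> _; exists (fun m => if choice.unpickle m is Some (n, i) then nth j0 (A n) i else j0) => j pj.
(* Half of [p j], because the sums over [A n] with and without [j] are both within [1 / n.+1] of
   1. *)
have pj0 : 0 < p j / 2 by rewrite divr_gt0// lt_neqAle eq_sym pj p_ge0.
have [n hn] := exists_invn_lt pj0.
suff jA : j \in A n by exists (choice.pickle (n, index j (A n))); rewrite choice.pickleK nth_index.
apply: contraT => jA; exfalso.
have h1 := hA n _ (fsubset_refl _).
have h2 := hA n _ (fsubsetUr [fset j]%fset (A n)).
move: h2; rewrite partial_sumE big_fsetU1//= -partial_sumE => h2.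
by move: h1 h2 hn; rewrite !ltr_norml; move: (psum p (A n)) (p j) (n.+1%:R^-1) => P q w; lra.
Qed.

(** Eliminate the basis vectors of the support one after the other. The remainder then tends to 0 in
    quadratic form at every vector, and Cauchy-Schwarz for the remainder extends this to pairs of
    vectors. *)
Lemma density_decomposition : exists w : nat -> V,
  (fun n => \sum_(k < n) nr (w k) ^+ 2) @ \oo --> (1 : R) /\
  forall x y, ((fun n => \sum_(k < n) dot x (w k) * dot (w k) y) : nat -> R[i]^o)
    @ \oo --> (dot (rho x) y : R[i]^o).
Proof.
have [s sP] := density_support; pose u k := e (s k).
have hA := density_positive; have qA := positive_operator_form hA.
pose r n x := complex.Re (dot (cholesky rho u n x) x).
have qn n := positive_operator_form (cholesky_positive u hA n).
have r_ge0 n x : 0 <= r n x by exact: (quad_ge0 (qn n)).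
have r_le n x : r n x <= complex.Re (dot (rho x) x) by exact: cholesky_quad_le.
have squeeze (f g : nat -> R) : (forall n, 0 <= f n <= g n) -> g @ \oo --> (0 : R) -> f @ \oo --> (0 : R).
  move=> fg g0; apply: (squeeze_cvgr _ (cvg_cst (0 : R)) g0); exact: nearW.
have rD x y : r ^~ x @ \oo --> (0 : R) -> r ^~ y @ \oo --> (0 : R) ->
    r ^~ (x + y) @ \oo --> (0 : R).
  move=> rx ry; apply: (squeeze _ (fun n => 2 * r n x + 2 * r n y)).
    by move=> n; rewrite r_ge0 (quadD_le (qn n)).
  rewrite -(addr0 (0 : R)) -{1}(mulr0 2) -{2}(mulr0 2).
  by apply: cvgD; apply: cvgMr.
have rZ a x : r ^~ x @ \oo --> (0 : R) -> r ^~ (a *: x) @ \oo --> (0 : R).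
  move=> rx; rewrite /r; under eq_fun do rewrite (quadZ (qn _)).
  by rewrite -(mulr0 (nr a ^+ 2)); exact: cvgMr.
have re j : r ^~ (e j) @ \oo --> (0 : R).
  have [pj|/sP[k <-]] := eqVneq (p j) 0.
    apply: (squeeze _ (fun=> 0)); last exact: cvg_cst.
    by move=> n; rewrite r_ge0 -pj r_le.
  apply: cvg_near_cst; exists k.+1 => // n /= kn.
  by rewrite /r cholesky_eq0// linear0l.
have rsum x J : r ^~ (psum (fun j => dot x (e j) *: e j) J) @ \oo --> (0 : R).
  rewrite /summability.partial_sum; apply: (big_ind (fun z => r ^~ z @ \oo --> (0 : R))).
  - rewrite /r; under eq_fun do rewrite linear0r; exact: cvg_cst.
  - exact: rD.
  - by move=> i _; apply: rZ.
(* Finite expansions approximate [x]. On the tail [d J] the remainder is dominated by [rho]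
   uniformly in [n], and continuity of [rho] makes that bound small. *)
have r0 x : r ^~ x @ \oo --> (0 : R).
  have [rl rc _ _] := hrho.
  pose d J := x - psum (fun j => dot x (e j) *: e j) J.
  have d0 : d @ totally --> (0 : V).
    by rewrite -(subrr x); apply: cvgB; [exact: cvg_cst|exact: he.2].
  have rho0 : rho 0 = 0 by have := rl (-1) 0 0; rewrite !scaler0 addr0 scaleN1r addNr.
  have hd : (fun J => complex.Re (dot (rho (d J)) (d J))) @ totally --> (0 : R).
    have -> : 0 = complex.Re (dot (rho 0) 0) :> R by rewrite linear0r.
    apply: cvg_Re; apply: cvg_dot => //.
    exact: (cvg_comp d rho d0 (rc 0)).
  apply/cvgrPdist_lt => eps eps0; have e40 : 0 < eps / 4 by rewrite divr_gt0.
  move/cvgrPdist_lt : hd => /(_ _ e40)/filter_ex[J].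
  rewrite sub0r normrN => hJ.
  move/cvgrPdist_lt : (rsum x J) => /(_ _ e40).
  apply: filterS => n; rewrite !sub0r !normrN => hn.
  have := quadD_le (qn n) (psum (fun j => dot x (e j) *: e j) J) (d J).
  rewrite /d subrKC -/(r n x) -/(r n _) -/(d J) -/(r n _) => h.
  have := r_le n (d J); move: hn hJ; rewrite !ltr_norml.
  by have := r_ge0 n x; lra.
exists (cholesky_vector rho u); split; last first.
  move=> x y; apply/cvg_nrP => eps eps0.
  have q0 := quad_ge0 qA y.
  have e1 : 0 < eps ^+ 2 / (complex.Re (dot (rho y) y) + 1).
    by rewrite divr_gt0 ?exprn_gt0// ltr_wpDl.
  move/cvgrPdist_lt : (r0 x) => /(_ _ e1); apply: filterS => n.
  rewrite sub0r normrN ger0_norm// ltr_pdivlMr ?ltr_wpDl// => hn.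
  rewrite (cholesky_dot u hA n) addrC addKr.
  rewrite -(@ltr_pXn2r _ 2) ?nnegrE ?nr_ge0 ?(ltW eps0)//.
  rewrite (le_lt_trans (form_cauchy_schwarz (qn n) x y))// (le_lt_trans _ hn)//.
  apply: ler_pM => //; [exact: r_ge0|exact: r_ge0|].
  by rewrite (le_trans (r_le n y))// lerDl.
(* By Parseval the sum of squared norms is the trace of the eliminated part, which is at most the
   trace of [rho]. *)
have le1 n : \sum_(k < n) nr (cholesky_vector rho u k) ^+ 2 <= 1.
  have h : (fun J => \sum_(k < n) psum (fun j => nr (dot (cholesky_vector rho u k) (e j)) ^+ 2) J)
      @ totally --> \sum_(k < n) nr (cholesky_vector rho u k) ^+ 2.
    apply: (cvg_sumr (f := fun (k : 'I_n) J => psum (fun j => nr (dot (cholesky_vector rho u k) (e j)) ^+ 2) J)) => k.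
    exact: parseval.
  rewrite -(cvg_lim _ h)//; apply: limr_le; first by apply/cvg_ex; eexists; exact: h.
  apply: nearW => J; rewrite /summability.partial_sum exchange_big/=.
  rewrite (le_trans _ (partial_sum_le_lim J p_ge0 psum_p))//.
  apply: ler_sum => j _; rewrite /p (cholesky_quad u hA n) lerDl; exact: r_ge0.
(* Lower bound: a finite [J] carries the trace up to [eps / 2], and over [J] the remainder
   eventually drops below [eps / 2]. *)
apply/cvgrPdist_lt => eps eps0; have e20 : 0 < eps / 2 by rewrite divr_gt0.
move/cvgrPdist_lt : psum_p => /(_ _ e20)/filter_ex[J hJ].
have hr : (fun n => psum (fun j => r n (e j)) J) @ \oo --> (0 : R).
  rewrite -(_ : psum (fun=> 0) J = 0); last by rewrite /summability.partial_sum big1.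
  by apply: (cvg_sumr (f := fun (j : J) n => r n (e (val j)))) => j; exact: re.
move/cvgrPdist_lt : hr => /(_ _ e20); apply: filterS => n; rewrite sub0r normrN => hn.
have : psum (fun j => p j - r n (e j)) J <= \sum_(k < n) nr (cholesky_vector rho u k) ^+ 2.
  apply: (@le_trans _ _ (\sum_(k < n) psum (fun j => nr (dot (cholesky_vector rho u k) (e j)) ^+ 2) J)).
    rewrite /summability.partial_sum exchange_big/= ler_sum// => j _.
    by rewrite /p (cholesky_quad u hA n) addrK.
  by apply: ler_sum => k _; exact: bessel.
rewrite /summability.partial_sum sumrB => h.
have {}h : psum p J - psum (fun j => r n (e j)) J <=
  \sum_(k < n) nr (cholesky_vector rho u k) ^+ 2 := h.
have := le1 n; move: hJ hn h; rewrite !ltr_norml; lra.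
Qed.

End density.

(** * Traces of a density operator between two unitaries *)

Section unitary_trace.
Context {I : choiceType} (e : I -> V) (rho : V -> V) (w : nat -> V).
Context (he : orthonormal_basis dot e).
Context (w1 : (fun n => \sum_(k < n) nr (w k) ^+ 2) @ \oo --> (1 : R)).
Context (wrho : forall x y, ((fun n => \sum_(k < n) dot x (w k) * dot (w k) y) : nat -> R[i]^o)
    @ \oo --> (dot (rho x) y : R[i]^o)).
Local Notation psum := summability.partial_sum.
Local Notation totally := summability.totally.

Lemma nr_isometry (A : V -> V) : (forall x y, dot (A x) (A y) = dot x y) ->
  forall x, nr (A x) = nr x.
Proof.
move=> hA x; apply/eqP; rewrite -(eqrXn2 (n := 2))// ?nr_ge0//.
by rewrite -!Re_dot hA.
Qed.

(** As [A] and [C] preserve inner products, the inverses acting on [e j] can be moved onto [w k].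
    What results is the trace of the sum of the operators |A w_k><C w_k|, to which [sum_dot_dot]
    applies. *)
Lemma unitary_trace (A A' C C' : V -> V) :
  (forall x y, dot (A x) (A y) = dot x y) -> (forall x, A (A' x) = x) ->
  (forall x y, dot (C x) (C y) = dot x y) -> (forall x, C (C' x) = x) ->
  exists2 W : R[i],
    ((fun n => \sum_(k < n) dot (A (w k)) (C (w k))) : nat -> R[i]^o) @ \oo --> (W : R[i]^o) &
    (psum (fun j => dot (A (rho (C' (e j)))) (e j)) : _ -> R[i]^o) @ totally --> (W : R[i]^o).
Proof.
move=> hA hA' hC hC'.
have Aw1 : (fun n => \sum_(k < n) nr (A (w k)) ^+ 2) @ \oo --> (1 : R).
  by under eq_fun do under eq_bigr do rewrite nr_isometry//.
have Cw1 : (fun n => \sum_(k < n) nr (C (w k)) ^+ 2) @ \oo --> (1 : R).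
  by under eq_fun do under eq_bigr do rewrite nr_isometry//.
have [W [WE [F FE FW]]] := sum_dot_dot (x := A \o w) (y := C \o w) he Aw1 Cw1.
exists W => //; rewrite (_ : (fun j => _) = F)//.
apply/funext => j; have := @wrho (C' (e j)) (A' (e j)).
rewrite (_ : (fun n => _) = (fun n => \sum_(k < n) dot (A (w k)) (e j) * dot (e j) (C (w k)))); last first.
  apply/funext => n; apply: eq_bigr => k _; rewrite mulrC; congr (_ * _).
    by rewrite -hA hA'.
  by rewrite -hC hC'.
rewrite -[in dot (rho _) _]hA hA' => h.
exact: (cvg_unique (@norm_hausdorff _ R[i]^o) h (FE j)).
Qed.

End unitary_trace.
End hilbert.

(** * Dephasing dynamics *)

Section mean_value.
Context {R : realType}.

Lemma is_derive_quotient (f : R -> R) (t l : R) :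
  (fun h => h^-1 * (f (t + h) - f t)) @ 0^' --> l -> is_derive t 1 f l.
Proof.
move=> fl.
have h : h^-1 *: ((f \o shift t) (h *: (1 : R)) - f t) @[h --> 0^'] --> l.
  by move: fl; apply: cvg_trans; apply: near_eq_cvg; near=> h; rewrite /= [h *: 1]mulr1 (addrC h).
split; first by apply/cvg_ex; exists l.
exact: cvg_lim h.
Unshelve. all: by end_near. Qed.

Lemma derive_bound (f df : R -> R) (a b C : R) : a <= b ->
  {within `[a, b], continuous f} ->
  (forall t, a < t < b -> is_derive t 1 f (df t)) ->
  (forall t, a < t < b -> `|df t| <= C) ->
  `|f b - f a| <= C * (b - a).
Proof.
rewrite le_eqVlt => /predU1P[->|ab] cf df1 dfC; first by rewrite !subrr normr0 mulr0.
have df1' x : x \in `]a, b[%R -> is_derive x 1 f (df x) by rewrite in_itv/=; exact: df1.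
have [c] := MVT ab df1' cf; rewrite in_itv/= => cab ->; rewrite normrM (gtr0_norm (_ : 0 < b - a)) ?subr_gt0//.
by rewrite ler_wpM2r ?dfC// subr_ge0 ltW.
Qed.
End mean_value.

(** * Derivatives of inner products and continuity of unitaries *)

Section dynamics.
Context {R : realType} {V : completeNormedModType R[i]} {dot : {dot V for Num.conj}}.
Context (hV : hilbert_space dot).

Lemma cvg_dot_quotient (X Y : R -> V) (X' Y' : V) (t : R) :
  (fun h : R => (h^-1)%:C *: (X (t + h) - X t)) @ 0^' --> X' ->
  (fun h : R => (h^-1)%:C *: (Y (t + h) - Y t)) @ 0^' --> Y' ->
  ((fun h : R => (h^-1)%:C * (dot (X (t + h)) (Y (t + h)) - dot (X t) (Y t))) : R -> R[i]^o)
    @ 0^' --> (dot X' (Y t) + dot (X t) Y' : R[i]^o).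
Proof.
move=> hX hY.
have Yt : (fun h : R => Y (t + h)) @ 0^' --> Y t.
  have h : (fun h : R => (h%:C : R[i]^o) *: ((h^-1)%:C *: (Y (t + h) - Y t)) + Y t) @ 0^' --> (0%:C : R[i]^o) *: Y' + Y t.
    apply: cvgD; last exact: cvg_cst.
    apply: cvgZ => //; apply: cvg_realcomplex; exact: cvg_within.
  rewrite scale0r add0r in h; move: h; apply: cvg_trans; apply: near_eq_cvg.
  near=> h; rewrite scalerA -rmorphM/= mulfV ?scale1r ?subrK//.
  by near: h; exact: nbhs_dnbhs_neq.
rewrite (_ : (fun h => _) = (fun h : R => dot ((h^-1)%:C *: (X (t + h) - X t)) (Y (t + h)) +
    dot (X t) ((h^-1)%:C *: (Y (t + h) - Y t)))).
  apply: (@cvgD _ R[i]^o); apply: (cvg_dot hV) => //; exact: cvg_cst.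
apply/funext => h.
rewrite (posformZl (dot_form hV)) (posformZr (dot_form hV)) linearBl linearBr/= conjcE conjc_real.
by ring.
Unshelve. all: by end_near. Qed.

(** Taking real parts makes the mean value theorem available; the free factor [lam] is later the
    conjugate of an increment. *)
Lemma is_derive_Re_dot (lam : R[i]) (X Y : R -> V) (X' Y' : V) (t : R) :
  (fun h : R => (h^-1)%:C *: (X (t + h) - X t)) @ 0^' --> X' ->
  (fun h : R => (h^-1)%:C *: (Y (t + h) - Y t)) @ 0^' --> Y' ->
  is_derive t 1 (fun u => complex.Re (lam * dot (X u) (Y u)))
    (complex.Re (lam * (dot X' (Y t) + dot (X t) Y'))).
Proof.
move=> hX hY; apply: is_derive_quotient.
rewrite (_ : (fun h => _) = (fun h : R => complex.Re (lam *
   ((h^-1)%:C * (dot (X (t + h)) (Y (t + h)) - dot (X t) (Y t)))))).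
  apply: cvg_Re; apply: (@cvgZr _ R[i]^o _ _ _ lam); exact: cvg_dot_quotient.
by apply/funext => h; rewrite -ReB -mulrBr -ReZ mulrCA.
Qed.

Definition sgn2 (a : 'I_2) : R := if a == 0 then 1 else -1.

Lemma tensor_sigma_z (X : V -> V) (psi : 'I_2 -> V) a :
  tensor (sigma_z R) X psi a = (sgn2 a)%:C *: X (psi a).
Proof.
rewrite /tensor (bigD1 a)//= big1 ?addr0 => [|b ba]; last first.
  by rewrite mxE eq_sym ba scale0r.
by rewrite mxE eqxx/= /sgn2; case: ifP; rewrite ?rmorphN1.
Qed.

Lemma tensor_1 (X : V -> V) (psi : 'I_2 -> V) a : tensor 1%:M X psi a = X (psi a).
Proof.
rewrite /tensor (bigD1 a)//= big1 ?addr0 => [|b ba]; last first.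
  by rewrite mxE eq_sym (negbTE ba) scale0r.
by rewrite mxE eqxx scale1r.
Qed.

Lemma dephasing_hamiltonianE (B : R) (HB HSB : partial_operator V) psi a :
  act (dephasing_hamiltonian B HB HSB) psi a =
  (- (2^-1 * B) * sgn2 a)%:C *: psi a + act HB (psi a) + (sgn2 a)%:C *: act HSB (psi a).
Proof.
rewrite -[LHS]/((- (2^-1 * B))%:C *: (tensor (sigma_z R) idfun psi a) + tensor 1%:M (act HB) psi a
  + tensor (sigma_z R) (act HSB) psi a).
by rewrite !tensor_sigma_z tensor_1 scalerA -rmorphM.
Qed.

Lemma Re_dot2 psi : complex.Re (dot2 dot psi psi) = \sum_a nr (psi a) ^+ 2.
Proof. by rewrite /dot2 Re_sum; apply: eq_bigr => a _; rewrite Re_dot. Qed.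

(** Both sides are compared with the Hilbert norm of the pair. This is the continuity estimate
    behind [unitary_cvg]. *)
Lemma unitary_nr_le A psi a : unitary dot A -> nr (A psi a) <= \sum_b nr (psi b).
Proof.
move=> [_ Aiso _].
rewrite -(@ler_pXn2r _ 2) ?nnegrE ?sumr_ge0 ?nr_ge0//; last by move=> *; exact: nr_ge0.
apply: (@le_trans _ _ (\sum_b nr (psi b) ^+ 2)).
  rewrite -Re_dot2 -Aiso Re_dot2 (bigD1 a)//= lerDl sumr_ge0// => b _; exact: sqr_ge0.
rewrite !big_ord_recr !big_ord0/= !add0r sqrrD -addrA lerD2l lerDr.
by rewrite mulrn_wge0// mulr_ge0// nr_ge0.
Qed.

Lemma dense2_sequence (D : set ('I_2 -> V)) (psi : 'I_2 -> V) : dense2 D ->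
  exists s : nat -> 'I_2 -> V, (forall n, D (s n)) /\
    forall a, (fun n => s n a) @ \oo --> psi a.
Proof.
move=> dD.
have h n : exists phi, D phi /\ forall a, nr (psi a - phi a) < n.+1%:R^-1.
  have n0 : (0 : R) < n.+1%:R^-1 by rewrite invr_gt0.
  have [phi Dphi hphi] := dD psi _ n0; exists phi; split => // a.
  by have := hphi a; rewrite nrE ltcR.
exists (fun n => sval (cid (h n))); split=> [n|a]; first by have [] := svalP (cid (h n)).
apply/cvg_nrP => eps eps0; have [k ke] := exists_invn_lt eps0; exists k => // n /= kn.
have [_ /(_ a) h1] := svalP (cid (h n)); rewrite (lt_trans h1)// (le_lt_trans _ ke)//.
by rewrite lef_pV2 ?posrE// ler_nat.
Qed.

Lemma unitary_cvg A (s : nat -> 'I_2 -> V) psi : unitary dot A ->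
  (forall a, (fun n => s n a) @ \oo --> psi a) ->
  forall a, (fun n => A (s n) a) @ \oo --> A psi a.
Proof.
move=> uA spsi a; have [linA _ _] := uA.
have AB phi chi : A (phi - chi) = A phi - A chi.
  by rewrite addrC -scaleN1r linA scaleN1r addrC.
apply/cvg_nrP => eps eps0; have e20 : 0 < eps / 2 by rewrite divr_gt0.
have near_s b : \forall n \near \oo, nr (psi b - s n b) < eps / 2.
  exact: ((@cvg_nrP _ _ _ _ _ _ _).1 (spsi b)).
apply: filterS2 (near_s 1) (near_s 0) => n h1 h0; rewrite -[A psi a - _]/((A psi - A (s n)) a) -AB.
rewrite (le_lt_trans (unitary_nr_le _ _ uA))// !big_ord_recr big_ord0/= add0r.
rewrite [ltRHS]splitr; apply: ltrD.
  by rewrite (_ : widen_ord _ _ = 0)//; exact/val_inj.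
by rewrite (_ : ord_max = 1)//; exact/val_inj.
Qed.

(** * Evolution under a dephasing Hamiltonian *)

Section evolution.
Context (B : R) (HB HSB : R -> partial_operator V).
Context (UQ : R -> ('I_2 -> V) -> ('I_2 -> V)).
Context (hHB : forall t : R, 0 <= t -> hermitian_operator dot (HB t)).
Context (hHSB : forall t : R, 0 <= t -> hermitian_operator dot (HSB t)).
Context (hUQ : evolution_operator dot
  (fun t => dephasing_hamiltonian B (HB t) (HSB t)) UQ).

(* The form of -B/2 + H_SB.  In the derivative of an overlap it comes with the
   difference of two signs of sigma_z, and H_B cancels. *)
Let coupling t (x y : V) : R[i] := (- (2^-1 * B))%:C * dot x y + dot (act (HSB t) x) y.

Lemma evolution_unitary t : 0 <= t -> unitary dot (UQ t).
Proof. by have [_ + _ _] := hUQ => /[apply]. Qed.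

Let overlap psi phi a b (u : R) := dot (UQ u psi a) (UQ u phi b).

Definition schroedinger (D : set ('I_2 -> V)) : Prop :=
  forall psi, D psi -> forall t : R, 0 < t ->
    dom (dephasing_hamiltonian B (HB t) (HSB t)) (UQ t psi) /\
    forall a, (fun h : R => (h^-1)%:C *: (UQ (t + h) psi a - UQ t psi a)) @ 0^'
      --> - 'i%C *: act (dephasing_hamiltonian B (HB t) (HSB t)) (UQ t psi) a.

Lemma overlap_continuous psi phi a b (lam : R[i]) u v : 0 <= u ->
  {within `[u, v], continuous (fun t => complex.Re (lam * overlap psi phi a b t))}.
Proof.
move=> u0; have [_ _ cU _] := hUQ.
have cUuv psi' a' : {within `[u, v], continuous (fun t => UQ t psi' a')}.
  apply: (continuous_subspaceW _ (cU psi' a')) => x /=.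
  by rewrite !in_itv/= andbT => /andP[ux _]; exact: le_trans ux.
move=> x; have FF : Filter (nbhs_subspace x) by exact: nbhs_subspace_filter.
apply: (@cvg_Re _ _ _ FF (fun t => lam * overlap psi phi a b t)).
apply: (@cvgZr _ R[i]^o _ _ _ lam); apply: (cvg_dot hV); exact: cUuv.
Qed.

Lemma overlap_derive (D : set ('I_2 -> V)) psi phi a b (lam : R[i]) (t : R) :
  schroedinger D ->
  D psi -> D phi -> 0 < t ->
  is_derive t 1 (fun u => complex.Re (lam * overlap psi phi a b u))
    (complex.Re (lam * (- 'i%C * ((sgn2 a - sgn2 b)%:C * coupling t (UQ t psi a) (UQ t phi b))))).
Proof.
move=> DU Dpsi Dphi t0.
have [dpsi /(_ a) hpsi] := DU _ Dpsi _ t0; have [dphi /(_ b) hphi] := DU _ Dphi _ t0.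
have := is_derive_Re_dot (X := fun u => UQ u psi a) (Y := fun u => UQ u phi b) lam hpsi hphi.
rewrite !dephasing_hamiltonianE.
have [_ _ _ symB] := hHB (ltW t0); have [_ _ _ symSB] := hHSB (ltW t0).
have [dBX dSX] := dpsi a; have [dBY dSY] := dphi b.
rewrite (posformZl (dot_form hV)) (posformZr (dot_form hV)).
rewrite !(posformDl (dot_form hV)) !(posformDr (dot_form hV)).
rewrite !(posformZl (dot_form hV)) !(posformZr (dot_form hV)).
rewrite -(symB _ _ dBX dBY) -(symSB _ _ dSX dSY).
congr is_derive; congr (complex.Re (_ * _)).
rewrite rmorphN/= conj_i opprK !conjcE !conjc_real /coupling !rmorphM rmorphB rmorphN/=.
by ring.
Qed.

(** A complex function has no mean value theorem; projecting it on the direction of its own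
    increment [d] leaves a real function with increment [nr d ^+ 2]. *)
Lemma overlap_bound (D : set ('I_2 -> V)) psi phi a b (u v C : R) :
  schroedinger D ->
  D psi -> D phi -> 0 <= u -> u <= v ->
  (forall t, u < t < v ->
    nr ((sgn2 a - sgn2 b)%:C * coupling t (UQ t psi a) (UQ t phi b)) <= C) ->
  nr (overlap psi phi a b v - overlap psi phi a b u) <= C * (v - u).
Proof.
move=> DU Dpsi Dphi u0 uv hC; set d := _ - _.
(* For a zero increment the claim needs [0 <= C], which the hypothesis supplies at the midpoint of a
   nondegenerate interval. *)
have [->|d0] := eqVneq (nr d) 0.
  move: uv; rewrite le_eqVlt => /predU1P[->|uv]; first by rewrite subrr mulr0.
  rewrite mulr_ge0 ?subr_ge0 ?(ltW uv)//.
  apply: le_trans (nr_ge0 _) (hC ((u + v) / 2) _).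
  by rewrite midf_lt// midf_lt.
have {}d0 : 0 < nr d by rewrite lt_neqAle eq_sym d0 nr_ge0.
have dE t : u < t < v -> _ := fun tuv => overlap_derive a b d^* DU Dpsi Dphi
  (le_lt_trans u0 (andP tuv).1).
have := @derive_bound _ _ _ _ _ (nr d * C) uv (@overlap_continuous psi phi a b d^* u v u0) dE.
have -> : complex.Re (d^* * overlap psi phi a b v) - complex.Re (d^* * overlap psi phi a b u) = nr d ^+ 2.
  by rewrite -ReB -mulrBr -/d mulrC mul_conj.
rewrite ger0_norm ?sqr_ge0// expr2 -mulrA ler_pM2l//.
apply => t tuv; rewrite (le_trans (Re_le_nr _))// nrM nr_conj ler_pM2l//.
rewrite nrM nrN (_ : nr 'i%C = 1) ?mul1r ?hC//.
by rewrite -[RHS](nr_iunit (R := R) 1) /iunit expr1.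
Qed.

(** Equal signs of sigma_z make the derivative vanish on [D], so [overlap_bound] applies with the
    constant 0; density and unitarity give all states. *)
Lemma overlap_diag psi phi a (t : R) : 0 <= t ->
  dot (UQ t psi a) (UQ t phi a) = dot (psi a) (phi a).
Proof.
move=> t0; have [U0 uU _ [D dD DU]] := hUQ.
have onD psi' phi' : D psi' -> D phi' -> overlap psi' phi' a a t = dot (psi' a) (phi' a).
  move=> Dpsi Dphi; apply/eqP; rewrite -subr_eq0; apply/eqP/nr0_eq0.
  have := @overlap_bound D psi' phi' a a 0 t 0 DU Dpsi Dphi (lexx _) t0.
  rewrite /overlap !U0 mul0r => h; apply/eqP; rewrite eq_le nr_ge0 andbT; apply: h => s _.
  by rewrite subrr mul0r nr0.
have [s [Ds spsi]] := dense2_sequence psi dD; have [s' [Ds' sphi]] := dense2_sequence phi dD.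
have h1 : ((fun n => dot (UQ t (s n) a) (UQ t (s' n) a)) : nat -> R[i]^o) @ \oo
    --> (dot (UQ t psi a) (UQ t phi a) : R[i]^o).
  by apply: (cvg_dot hV); apply: unitary_cvg => //; exact: uU.
have h2 : ((fun n => dot (UQ t (s n) a) (UQ t (s' n) a)) : nat -> R[i]^o) @ \oo
    --> (dot (psi a) (phi a) : R[i]^o).
  have -> : (fun n => dot (UQ t (s n) a) (UQ t (s' n) a)) = (fun n => dot (s n a) (s' n a)).
    by apply/funext => n; exact: onD.
  by apply: (cvg_dot hV).
exact: (cvg_unique (@norm_hausdorff _ R[i]^o) h1 h2).
Qed.

(** The diagonal block U_0 or U_1 of the evolution. *)
Definition component a t (x : V) : V := UQ t (ket a x) a.

(** The state [psi - ket a (psi a)] has no component [a], and by [overlap_diag] it never acquires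
    one. *)
Lemma evolutionE psi a t : 0 <= t -> UQ t psi a = component a t (psi a).
Proof.
move=> t0; have [linU _ _] := evolution_unitary t0.
have := overlap_diag (psi - ket a (psi a)) (psi - ket a (psi a)) a t0.
rewrite -[(psi - ket a (psi a)) a]/(psi a - (a == a)%:R *: psi a) eqxx scale1r subrr.
rewrite linear0l => h.
have -> : UQ t psi = UQ t (psi - ket a (psi a)) + UQ t (ket a (psi a)).
  by have := linU 1 (psi - ket a (psi a)) (ket a (psi a)); rewrite !scale1r subrK.
rewrite -[LHS]/(UQ t (psi - ket a (psi a)) a + component a t (psi a)).
suff -> : UQ t (psi - ket a (psi a)) a = 0 by rewrite add0r.
by apply: nr0_eq0; apply/eqP; rewrite -sqrf_eq0 -(Re_dot hV) h.
Qed.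

Lemma component_isometry a t x y : 0 <= t ->
  dot (component a t x) (component a t y) = dot x y.
Proof.
by move=> t0; rewrite /component overlap_diag// /ket eqxx !scale1r.
Qed.

Lemma component_surjective a t y : 0 <= t -> exists x, component a t x = y.
Proof.
move=> t0; have [_ _ surj] := evolution_unitary t0.
have [psi Upsi] := surj (ket a y); exists (psi a).
by rewrite -evolutionE// Upsi /ket eqxx scale1r.
Qed.

Lemma component_linear a t : 0 <= t -> linear (component a t).
Proof.
move=> t0 k x y; have [linU _ _] := evolution_unitary t0.
have := linU k (ket a x) (ket a y).
have -> : k *: ket a x + ket a y = ket a (k *: x + y) :> ('I_2 -> V).
  apply/funext => b; rewrite -[LHS]/(k *: ket a x b + ket a y b).
  by rewrite /ket scalerDr !scalerA mulrC.
by rewrite /component => ->.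
Qed.

(** [adjoint] is a choice among vectors with the adjoint property: unitarity shows that [ket b y] is
    one, and definiteness of the inner product that there is no other. *)
Lemma adjoint_evolution b t x : 0 <= t -> forall y, component b t y = x ->
  adjoint dot (UQ t) (ket b x) = ket b y.
Proof.
move=> t0 y yx; have [linU isoU _] := evolution_unitary t0.
have Uy : UQ t (ket b y) = ket b x.
  apply/funext => a; rewrite evolutionE// /ket; case: eqVneq => [->|ab].
    by rewrite !scale1r yx.
  rewrite !scale0r; apply: nr0_eq0; apply/eqP; rewrite -sqrf_eq0 -(Re_dot hV).
  by rewrite component_isometry// linear0l.
rewrite /adjoint; case: xgetP => [phi _ /= hphi|/(_ (ket b y)) /=]; last first.
  by case=> chi; rewrite -Uy isoU.
have : forall chi, dot2 dot chi (phi - ket b y) = 0.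
  move=> chi; have := hphi chi; rewrite -Uy isoU => h.
  rewrite /dot2; under eq_bigr do rewrite linearBr/=.
  by rewrite sumrB; apply/eqP; rewrite subr_eq0 eq_sym; apply/eqP.
move=> /(_ (phi - ket b y)) /(congr1 (@complex.Re R)).
rewrite Re_dot2 => /eqP; rewrite psumr_eq0 => [/allP h|a _]; last exact: sqr_ge0.
apply/funext => a; apply/eqP; rewrite -subr_eq0.
have := h a (mem_index_enum _); rewrite sqrf_eq0 => /eqP/nr0_eq0 /= ha.
by apply/eqP; exact: ha.
Qed.

(** The coupling is at most |B|/2 + |M| in norm, and the eigenvalues of sigma_z differ by 2. The
    bound on [HSB] is stated with an [M] of any sign, hence the absolute value. *)
Lemma overlap_lipschitz (t M u v : R) x y : 0 <= u -> u <= v -> v <= t ->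
  (forall u : R, 0 < u < t -> forall x, dom (HSB u) x -> `|act (HSB u) x| <= M%:C * `|x|) ->
  nr (dot (component 0 v x) (component 1 v y) - dot (component 0 u x) (component 1 u y))
    <= (`|B| + 2 * `|M|) * nr x * nr y * (v - u).
Proof.
move=> u0 uv vt hM; have [U0 uU _ [D dD DU]] := hUQ.
have v0 := le_trans u0 uv.
have onD psi phi : D psi -> D phi -> nr (overlap psi phi 0 1 v - overlap psi phi 0 1 u) <=
    (`|B| + 2 * `|M|) * nr (psi 0) * nr (phi 1) * (v - u).
  move=> Dpsi Dphi; apply: (@overlap_bound D) => // s /andP[us sv].
  have s0 : 0 < s by exact: le_lt_trans us.
  have st : s < t by exact: lt_le_trans vt.
  have [dpsi _] := DU _ Dpsi _ s0.
  have nrU psi' a : nr (UQ s psi' a) = nr (psi' a).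
    apply/eqP; rewrite -(eqrXn2 (n := 2))// ?nr_ge0// -!(Re_dot hV).
    by rewrite overlap_diag// ltW.
  rewrite (_ : sgn2 0 - sgn2 1 = 2); last by rewrite /sgn2/= opprK.
  rewrite nrM nrC ger0_norm// /coupling.
  have hc1 : nr (dot (UQ s psi 0) (UQ s phi 1)) <= nr (psi 0) * nr (phi 1).
    by rewrite (le_trans (nr_dot_le hV _ _))// !nrU.
  have hc2 : nr (dot (act (HSB s) (UQ s psi 0)) (UQ s phi 1)) <= `|M| * nr (psi 0) * nr (phi 1).
    rewrite (le_trans (nr_dot_le hV _ _))// nrU ler_wpM2r ?nr_ge0//.
    have [_ dSB] := dpsi 0; have := hM s; rewrite s0 st => /(_ isT _ dSB).
    rewrite !nrE -rmorphM lecR nrU => /le_trans; apply.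
    by rewrite ler_wpM2r ?nr_ge0// ler_norm.
  apply: (@le_trans _ _ (2 * (2^-1 * `|B| * (nr (psi 0) * nr (phi 1)) + `|M| * nr (psi 0) * nr (phi 1)))).
    rewrite ler_pM2l// (le_trans (nrD _ _))// lerD// nrM nrC normrN normrM.
    by rewrite (ger0_norm (_ : 0 <= 2^-1))// ler_wpM2l// mulr_ge0.
  by rewrite le_eqVlt; apply/orP; left; apply/eqP; field.
(* Both vectors are put into one state, [x] in component 0 and [y] in component 1, which is then
   approximated within [D]. *)
have [s [Ds spsi]] := dense2_sequence (fun a => if a == 0 then x else y) dD.
have ovE w psi : 0 <= w -> overlap psi psi 0 1 w = dot (component 0 w (psi 0)) (component 1 w (psi 1)).
  by move=> w0; rewrite /overlap !evolutionE.
pose p : 'I_2 -> V := fun a => if a == 0 then x else y.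
have cv w : 0 <= w -> ((fun n => overlap (s n) (s n) 0 1 w) : nat -> R[i]^o) @ \oo --> (overlap p p 0 1 w : R[i]^o).
  by move=> w0; apply: (cvg_dot hV); apply: unitary_cvg => //; exact: uU.
rewrite -[x]/(p 0) -[y]/(p 1) -!ovE//.
have l1 : (fun n => nr (overlap (s n) (s n) 0 1 v - overlap (s n) (s n) 0 1 u)) @ \oo -->
    nr (overlap p p 0 1 v - overlap p p 0 1 u).
  by apply: (@cvg_nr _ R[i]^o); apply: (@cvgB _ R[i]^o); exact: cv.
have l2 : (fun n => (`|B| + 2 * `|M|) * nr (s n 0) * nr (s n 1) * (v - u)) @ \oo -->
    (`|B| + 2 * `|M|) * nr (p 0) * nr (p 1) * (v - u).
  apply: cvgMl; apply: cvgM; last by apply: cvg_nr; exact: spsi.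
  by apply: cvgMr; apply: cvg_nr; exact: spsi.
apply: (ler_cvg_to l1 l2); apply: nearW => n; exact: onD.
Qed.

(** * Trace over the bath *)

Section reduced.
Context {I : choiceType} (e : I -> V) (rho : V -> V).
Context (he : orthonormal_basis dot e).
Context (hrho : density_operator dot e rho).

Lemma tensor_ket (A : 'M[R[i]]_2) b y a :
  tensor A rho (ket b y) a = A a b *: rho y.
Proof.
have [linr _ _ _] := hrho.
have rho0 : rho 0 = 0 by have := linr (-1) 0 0; rewrite !scaler0 addr0 scaleN1r addNr.
rewrite /tensor (bigD1 b)//= big1 ?addr0 => [|c cb]; last first.
  by rewrite /ket (negbTE cb) scale0r rho0 scaler0.
by rewrite /ket eqxx scale1r.
Qed.

Lemma cvg_conjC {T} {F : set_system T} {FF : Filter F} (f : T -> R[i]) (l : R[i]) :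
  (f : T -> R[i]^o) @ F --> (l : R[i]^o) ->
  ((fun x => (f x)^*) : T -> R[i]^o) @ F --> (l^* : R[i]^o).
Proof.
move=> /cvg_nrP fl; apply/cvg_nrP => eps /fl; apply: filterS => x.
by rewrite -rmorphB nr_conj.
Qed.

(** The vectors [w] come from the initial bath state and serve all times, so [W] at different times
    can be compared term by term. *)
Lemma reduced_state_overlap : exists (w : nat -> V) (W : R -> R[i]),
  (fun n => \sum_(k < n) nr (w k) ^+ 2) @ \oo --> (1 : R) /\
  forall t, 0 <= t ->
    ((fun n => \sum_(k < n) dot (component 0 t (w k)) (component 1 t (w k))) : nat -> R[i]^o)
      @ \oo --> (W t : R[i]^o) /\
    forall rhoS, reduced_state dot e (UQ t) rhoS rho =
      \matrix_(a, b) (rhoS a b * (if a == b then 1 else if a == 0 then W t else (W t)^*)).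
Proof.
have [w [w1 wrho]] := density_decomposition hV he hrho.
have compI a t : 0 <= t -> exists f : V -> V, forall x, component a t (f x) = x.
  move=> t0; exists (fun y => sval (cid (component_surjective a y t0))) => y.
  exact: svalP (cid (component_surjective a y t0)).
have tr t (t0 : 0 <= t) a b := unitary_trace hV he w1 wrho
  (fun x y => component_isometry a x y t0) (svalP (cid (compI a t t0)))
  (fun x y => component_isometry b x y t0) (svalP (cid (compI b t t0))).
(* The value 0 at negative times only makes [W] total. *)
exists w, (fun t => if pselect (0 <= t) is left t0 then
  s2val (cid2 (tr t t0 0 1)) else 0); split => // t t0.
case: pselect => // t0'; rewrite {t0}.
move: t0' => t0; set W := s2val _; have W1 := s2valP (cid2 (tr t t0 0 1)).
rewrite -/W in W1; split => // rhoS; apply/matrixP => a b; rewrite !mxE.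
have [W' h1 h2] := tr t t0 a b.
have -> : (if a == b then 1 else if a == 0 then W else W^*) = W'.
  apply: (cvg_unique (@norm_hausdorff _ R[i]^o) _ h1).
  case: eqVneq => [<-|ab].
    have -> : (fun n => \sum_(k < n) dot (component a t (w k)) (component a t (w k))) =
        (fun n => (\sum_(k < n) nr (w k) ^+ 2)%:C).
      apply/funext => n; rewrite rmorph_sum/=; apply: eq_bigr => k _.
      by rewrite component_isometry// dotE.
    exact: cvg_realcomplex w1.
  have two (c : 'I_2) : c = 0 \/ c = 1.
    by case: c => [[|[|//]] ?]; [left|right]; exact/val_inj.
  have [[a0 b0]|[a1 b0]] : (a = 0 /\ b = 1) \/ (a = 1 /\ b = 0).
    by move: (two a) (two b) ab => [->|->] [->|->]; rewrite ?eqxx => // _; [left|right].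
    by rewrite a0 b0 eqxx; exact: W1.
  have -> : (a == 0) = false by rewrite a1.
  rewrite a1 b0.
  have -> : (fun n => \sum_(k < n) dot (component 1 t (w k)) (component 0 t (w k))) =
      (fun n => (\sum_(k < n) dot (component 0 t (w k)) (component 1 t (w k)))^*).
    apply/funext => n; rewrite rmorph_sum/=; apply: eq_bigr => k _.
    exact: dot_conj.
  exact: (cvg_conjC W1).
(* The block (a, b) of the evolved state is [rhoS a b] times U_a rho U_b^-1. *)
have psumE : summability.partial_sum (fun j =>
    dot (UQ t (tensor rhoS rho (adjoint dot (UQ t) (ket b (e j)))) a) (e j)) =
    fun J => rhoS a b * summability.partial_sum
      (fun j => dot (component a t (rho (sval (cid (compI b t t0)) (e j)))) (e j)) J.
  apply/funext => J; rewrite /summability.partial_sum mulr_sumr; apply: eq_bigr => j _.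
  rewrite (adjoint_evolution t0 (svalP (cid (compI b t t0)) (e (val j)))).
  rewrite evolutionE// tensor_ket -(posformZl (dot_form hV)); congr (dot _ _).
  have := component_linear a t0 (rhoS a b) (rho (sval (cid (compI b t t0)) (e (val j)))) 0.
  have lin0 : component a t 0 = 0.
    by have := component_linear a t0 (-1) 0 0; rewrite !scaler0 addr0 scaleN1r addNr.
  by rewrite lin0 !addr0.
have FF : Filter (@summability.totally I) by exact: filter_filter.
have := @cvg_complexM R _ _ FF (rhoS a b) _ _ h2; rewrite -psumE => h3.
exact: (cvg_lim (@norm_hausdorff _ R[i]^o) h3).
Qed.

End reduced.
End evolution.
End dynamics.

(** * Coherence of the reduced state *)

Section overlap_estimates.
Context {R : realType}.

Lemma ReN (z : R[i]) : complex.Re (- z) = - complex.Re z.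
Proof. by case: z. Qed.

Lemma young_sqr (x y t : R) : 0 < t -> (x + y) ^+ 2 <= (1 + t) * x ^+ 2 + (1 + t^-1) * y ^+ 2.
Proof.
move=> t0; rewrite -subr_ge0.
have -> : (1 + t) * x ^+ 2 + (1 + t^-1) * y ^+ 2 - (x + y) ^+ 2 = t^-1 * (t * x - y) ^+ 2.
  by field; rewrite gt_eqF.
by rewrite mulr_ge0 ?sqr_ge0// invr_ge0 ltW.
Qed.

(** Young's inequality is an equality at [t = l / y]; adding [eps / 2] to both terms makes this
    quotient defined and positive. *)
Lemma le_add_of_young (x y l : R) : 0 <= x -> 0 <= y -> 0 <= l ->
  (forall t, 0 < t -> x ^+ 2 <= (1 + t) * y ^+ 2 + (1 + t^-1) * l ^+ 2) -> x <= y + l.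
Proof.
move=> x0 y0 l0 h; apply/ler_addgt0Pr => eps eps0.
have e20 : 0 < eps / 2 by rewrite divr_gt0.
have y'0 : 0 < y + eps / 2 by rewrite ltr_wpDl.
have l'0 : 0 < l + eps / 2 by rewrite ltr_wpDl.
have -> : y + l + eps = (y + eps / 2) + (l + eps / 2) by field.
rewrite -(@ler_pXn2r _ 2) ?nnegrE ?addr_ge0 ?(ltW y'0) ?(ltW l'0) ?(ltW e20)//.
have := h _ (divr_gt0 l'0 y'0); set y' := y + _; set l' := l + _ => hxy.
have yy : y ^+ 2 <= y' ^+ 2 by rewrite ler_pXn2r ?nnegrE ?(ltW y'0)// lerDl ltW.
have ll : l ^+ 2 <= l' ^+ 2 by rewrite ler_pXn2r ?nnegrE ?(ltW l'0)// lerDl ltW.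
rewrite (le_trans hxy)//.
have h1 : (1 + l' / y') * y ^+ 2 <= (1 + l' / y') * y' ^+ 2.
  by rewrite ler_wpM2l// addr_ge0// divr_ge0// ltW.
have h2 : (1 + (l' / y')^-1) * l ^+ 2 <= (1 + (l' / y')^-1) * l' ^+ 2.
  by rewrite ler_wpM2l// addr_ge0// invr_ge0 divr_ge0// ltW.
rewrite (le_trans (lerD h1 h2))// le_eqVlt; apply/orP; left; apply/eqP.
by field; rewrite !gt_eqF.
Qed.

Context {V : completeNormedModType R[i]} {dot : {dot V for Num.conj}}.
Context (hV : hilbert_space dot).
Context (w : nat -> V).
Context (w1 : (fun n => \sum_(k < n) nr (w k) ^+ 2) @ \oo --> (1 : R)).

Lemma overlap_sum_le (a z : nat -> V) (L : R) (al : R[i]) :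
  (forall k, nr (a k) <= L * nr (w k)) -> (forall k, nr (z k) = nr (w k)) ->
  ((fun n => \sum_(k < n) dot (a k) (z k)) : nat -> R[i]^o) @ \oo --> (al : R[i]^o) ->
  nr al <= L.
Proof.
move=> aL zw hal.
have l1 : (fun n => nr (\sum_(k < n) dot (a k) (z k))) @ \oo --> nr al.
  exact: (@cvg_nr _ R[i]^o _ _ _ _ _ hal).
have l2 : (fun n => L * \sum_(k < n) nr (w k) ^+ 2) @ \oo --> L.
  by rewrite -[X in _ --> X]mulr1; exact: cvgMr.
apply: (ler_cvg_to l1 l2); apply: nearW => n.
rewrite (le_trans (nr_sum _ _ _))// mulr_sumr ler_sum// => k _.
by rewrite (le_trans (nr_dot_le hV _ _))// zw expr2 mulrA ler_wpM2r ?nr_ge0.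
Qed.

(** The squared distance from [w] to [c] times [b] in the l^2-sum of copies of [V], expanded. *)
Lemma distance_sum_cvg (b : nat -> V) (be c : R[i]) :
  (forall k, nr (b k) = nr (w k)) ->
  ((fun n => \sum_(k < n) dot (b k) (w k)) : nat -> R[i]^o) @ \oo --> (be : R[i]^o) ->
  (fun n => \sum_(k < n) nr (w k + (- c) *: b k) ^+ 2) @ \oo -->
    1 - 2 * complex.Re (c^* * be^*) + nr c ^+ 2.
Proof.
move=> bw hbe.
have -> : (fun n => \sum_(k < n) nr (w k + (- c) *: b k) ^+ 2) =
    (fun n => \sum_(k < n) nr (w k) ^+ 2 - 2 * complex.Re (c^* * (\sum_(k < n) dot (b k) (w k))^*)
       + nr c ^+ 2 * \sum_(k < n) nr (w k) ^+ 2).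
  apply/funext => n; rewrite rmorph_sum mulr_sumr Re_sum mulr_sumr -sumrN mulr_sumr -!big_split/=.
  apply: eq_bigr => k _; rewrite (nrBZ_sqr hV) nrN bw rmorphN mulNr/=.
  by rewrite -(dot_conj hV) ReN mulrN.
apply: cvgD; last by rewrite -[X in _ --> X]mulr1; exact: cvgMr.
apply: cvgB => //; apply: cvgMr; apply: cvg_Re.
by apply: cvg_complexM; exact: cvg_conjC.
Qed.

(* 1 - |al|^2 is the square of the distance from w to the line spanned by a in the
   l^2-sum of copies of V, and a distance to a moving line needs no
   differentiability, even where |al| = 1.  The triangle inequality of that
   l^2-sum is replaced by Young's inequality on each term. *)
Lemma overlap_defect_lipschitz (a b : nat -> V) (L : R) (al be : R[i]) :
  0 <= L ->
  (forall k, nr (a k) = nr (w k)) -> (forall k, nr (b k) = nr (w k)) ->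
  (forall k, nr (a k - b k) <= L * nr (w k)) ->
  ((fun n => \sum_(k < n) dot (a k) (w k)) : nat -> R[i]^o) @ \oo --> (al : R[i]^o) ->
  ((fun n => \sum_(k < n) dot (b k) (w k)) : nat -> R[i]^o) @ \oo --> (be : R[i]^o) ->
  Num.sqrt (1 - nr be ^+ 2) <= Num.sqrt (1 - nr al ^+ 2) + L.
Proof.
move=> L0 aw bw abL hal hbe.
have al1 : nr al <= 1.
  by apply: (overlap_sum_le (a := a) (z := w)) => // k; rewrite aw mul1r.
have be1 : nr be <= 1.
  by apply: (overlap_sum_le (a := b) (z := w)) => // k; rewrite bw mul1r.
have ge0 (z : R[i]) : nr z <= 1 -> 0 <= 1 - nr z ^+ 2.
  by move=> z1; rewrite subr_ge0 -(expr1n _ 2) ler_pXn2r ?nnegrE ?nr_ge0.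
apply: le_add_of_young; rewrite ?sqrtr_ge0// => t t0; rewrite !sqr_sqrtr ?ge0//.
(* The coefficient [al^*] gives the projection of [w] on the line of [a]. On the line of [b] it
   gives just some point, and its excess squared distance is [nr (al - be) ^+ 2]. *)
have qa := distance_sum_cvg (c := al^*) aw hal.
have qb := distance_sum_cvg (c := al^*) bw hbe.
have qaE : 1 - 2 * complex.Re (al^*^* * al^*) + nr (al^*) ^+ 2 = 1 - nr al ^+ 2.
  by rewrite conjCK mul_conj nr_conj/=; ring.
have qbE : 1 - 2 * complex.Re (al^*^* * be^*) + nr (al^*) ^+ 2 = 1 - nr be ^+ 2 + nr (al - be) ^+ 2.
  by rewrite conjCK nr_conj !nr_sqr; case: (al) (be) => [a1 a2] [b1 b2] /=; ring.
rewrite qaE in qa; rewrite qbE in qb.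
have ql : (fun n => (1 + t) * \sum_(k < n) nr (w k + (- al^*) *: a k) ^+ 2 +
    (1 + t^-1) * (L ^+ 2 * \sum_(k < n) nr (w k) ^+ 2)) @ \oo -->
    (1 + t) * (1 - nr al ^+ 2) + (1 + t^-1) * (L ^+ 2).
  apply: cvgD; first exact: cvgMr.
  by apply: cvgMr; rewrite -[X in _ --> X]mulr1; exact: cvgMr.
apply: (@le_trans _ _ (1 - nr be ^+ 2 + nr (al - be) ^+ 2)); first by rewrite lerDl sqr_ge0.
apply: (ler_cvg_to qb ql); apply: nearW => n.
rewrite !mulr_sumr -big_split/= ler_sum// => k _.
apply: (@le_trans _ _ ((nr (w k + (- al^*) *: a k) + L * nr (w k)) ^+ 2)); last first.
  by rewrite (le_trans (young_sqr _ _ t0))// exprMn.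
rewrite ler_pXn2r ?nnegrE ?addr_ge0 ?mulr_ge0 ?nr_ge0//.
have -> : w k + - al^* *: b k = (w k + - al^* *: a k) + al^* *: (a k - b k).
  by rewrite scalerBr !scaleNr addrACA addrA; congr (_ - _); rewrite addrAC subrK.
rewrite (le_trans (nrD _ _))// lerD2l nrZ nr_conj (le_trans _ (abL k))//.
by rewrite ler_piMl ?nr_ge0.
Qed.

End overlap_estimates.

(** * Regularity of the coherence in time *)

Section coherence_regularity.
Context {R : realType} {V : completeNormedModType R[i]} {dot : {dot V for Num.conj}}.
Context (hV : hilbert_space dot).
Context (B : R) (HB HSB : R -> partial_operator V).
Context (UQ : R -> ('I_2 -> V) -> ('I_2 -> V)).
Context (hHB : forall t : R, 0 <= t -> hermitian_operator dot (HB t)).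
Context (hHSB : forall t : R, 0 <= t -> hermitian_operator dot (HSB t)).
Context (hUQ : evolution_operator dot
  (fun t => dephasing_hamiltonian B (HB t) (HSB t)) UQ).
Context {I : choiceType} (e : I -> V) (rho : V -> V).
Context (he : orthonormal_basis dot e).
Context (hrho : density_operator dot e rho).

(** In the series for [W] both arguments move with time. Applying U_1^-1 to both fixes the second
    one at [w k], as [overlap_defect_lipschitz] requires. *)
Lemma reduced_state_coherence : exists W : R -> R[i],
  (forall t, 0 <= t -> forall rhoS, reduced_state dot e (UQ t) rhoS rho =
      \matrix_(a, b) (rhoS a b * (if a == b then 1 else if a == 0 then W t else (W t)^*))) /\
  forall t, 0 <= t -> bounded_on HSB t -> exists2 K : R, 0 <= K &
    forall u v, 0 <= u -> u <= v -> v <= t ->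
      [/\ nr (W u) <= 1, nr (W v - W u) <= K * (v - u) &
        `|Num.sqrt (1 - nr (W v) ^+ 2) - Num.sqrt (1 - nr (W u) ^+ 2)| <= K * (v - u)].
Proof.
have [w [W [w1 hW]]] := reduced_state_overlap hV hHB hHSB hUQ he hrho.
exists W; split=> [t t0 rhoS|t t0 [M hM]]; first by have [_] := hW t t0; exact.
exists (`|B| + 2 * `|M|) => [|u v u0 uv vt]; first by rewrite addr_ge0// mulr_ge0.
have v0 := le_trans u0 uv; set K := `|B| + _.
have K0 : 0 <= K by rewrite addr_ge0// mulr_ge0.
have iso a s x y : 0 <= s -> dot (component UQ a s x) (component UQ a s y) = dot x y.
  by move=> s0; exact: (component_isometry hV hHB hHSB hUQ).
have rel s (s0 : 0 <= s) : exists f : V -> V, forall x,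
    component UQ 1 s (f x) = component UQ 0 s x.
  exists (fun x => sval (cid (component_surjective hV hHB hHSB hUQ 1 (component UQ 0 s x) s0))) => x.
  exact: svalP (cid (component_surjective hV hHB hHSB hUQ 1 (component UQ 0 s x) s0)).
(* f and g are U_1^-1 U_0 at the times u and v. *)
have [f fC] := rel u u0; have [g gC] := rel v v0.
have fE x y : dot (f x) y = dot (component UQ 0 u x) (component UQ 1 u y) by rewrite -fC iso.
have gE x y : dot (g x) y = dot (component UQ 0 v x) (component UQ 1 v y) by rewrite -gC iso.
have nrC a s x : 0 <= s -> nr (component UQ a s x) = nr x.
  by move=> s0; apply: (nr_isometry hV) => y z; exact: iso.
have fn x : nr (f x) = nr x by rewrite -(nrC 1 u (f x))// fC nrC.
have gn x : nr (g x) = nr x by rewrite -(nrC 1 v (g x))// gC nrC.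
have gfL x : nr (g x - f x) <= K * (v - u) * nr x.
  (* Testing the overlap estimate against the difference [d] itself bounds [nr d ^+ 2] by a multiple
     of [nr d]. *)
  set d := g x - f x; have [->|d0] := eqVneq (nr d) 0.
    by rewrite !mulr_ge0 ?nr_ge0// subr_ge0.
  have {}d0 : 0 < nr d by rewrite lt_neqAle eq_sym d0 nr_ge0.
  rewrite -(ler_pM2r d0) -expr2 -(Re_dot hV) (le_trans (ler_norm _))//.
  rewrite (le_trans (Re_le_nr _))// {1}/d linearBl/= fE gE.
  have := overlap_lipschitz hV hHB hHSB hUQ x d u0 uv vt hM.
  by rewrite -/K => /le_trans; apply; rewrite le_eqVlt; apply/orP; left; apply/eqP; ring.
have fW : ((fun n => \sum_(k < n) dot (f (w k)) (w k)) : nat -> R[i]^o) @ \oo --> (W u : R[i]^o).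
  under eq_fun do under eq_bigr do rewrite fE.
  exact: (hW u u0).1.
have gW : ((fun n => \sum_(k < n) dot (g (w k)) (w k)) : nat -> R[i]^o) @ \oo --> (W v : R[i]^o).
  under eq_fun do under eq_bigr do rewrite gE.
  exact: (hW v v0).1.
have L0 : 0 <= K * (v - u) by rewrite mulr_ge0// subr_ge0.
have gfW : ((fun n => \sum_(k < n) dot (g (w k) - f (w k)) (w k)) : nat -> R[i]^o) @ \oo
    --> (W v - W u : R[i]^o).
  have -> : (fun n => \sum_(k < n) dot (g (w k) - f (w k)) (w k)) =
      (fun n => \sum_(k < n) dot (g (w k)) (w k) - \sum_(k < n) dot (f (w k)) (w k)).
    by apply/funext => n; rewrite -sumrB; apply: eq_bigr => k _; rewrite linearBl.
  apply: (cvgB gW fW).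
clearbody K; split.
- apply: (overlap_sum_le hV w1 (a := fun k => f (w k)) (z := w) _ (fun k => erefl) fW) => k.
  by rewrite fn mul1r.
- exact: (overlap_sum_le hV w1 (a := fun k => g (w k) - f (w k)) (z := w)
    (fun k => gfL (w k)) (fun k => erefl) gfW).
have h1 := overlap_defect_lipschitz hV w1 L0 (fun k => fn (w k)) (fun k => gn (w k)) _ fW gW.
have h2 := overlap_defect_lipschitz hV w1 L0 (fun k => gn (w k)) (fun k => fn (w k))
  (fun k => gfL (w k)) gW fW.
rewrite ler_norml; apply/andP; split; [lra|].
by rewrite lerBlDl; apply: h1 => k; rewrite nrB; exact: gfL.
Qed.

End coherence_regularity.

(** * Continuous phases *)

Section phases.
Context {R : realType}.

Lemma locally_lipschitz_absolutely_continuous (t C delta : R) (f : R -> R) : 0 <= C -> 0 < delta ->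
  (forall u v, 0 <= u -> u <= v -> v <= t -> v - u < delta -> `|f v - f u| <= C * (v - u)) ->
  absolutely_continuous 0 t f.
Proof.
move=> C0 d0 fC eps eps0; have C1 : 0 < C + 1 by rewrite ltr_wpDl.
exists (Num.min delta (eps / (C + 1))) => [|n x y xy _]; first by rewrite lt_min d0 divr_gt0.
rewrite lt_min => /andP[sd]; rewrite ltr_pdivlMr// => se.
have le_sum i : y i - x i <= \sum_j (y j - x j).
  rewrite (bigD1 i)//= lerDl sumr_ge0// => j _; rewrite subr_ge0; by have [] := xy j.
apply: le_lt_trans se; rewrite mulrC mulr_sumr ler_sum// => i _.
have [x0 xyi yt] := xy i; rewrite (le_trans (fC _ _ x0 xyi yt _))//.
  by rewrite (le_lt_trans (le_sum i)).
by rewrite ler_wpM2r ?subr_ge0// lerDl.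
Qed.

(** Near 0 the derivative of sin exceeds 1/2. *)
Lemma le_sin : exists2 eta : R, 0 < eta & forall x : R, `|x| <= eta -> `|x| <= 2 * `|sin x|.
Proof.
have /cvgrPdist_lt /(_ (1 / 2)) : cos x @[x --> (0 : R)] --> cos (0 : R) by exact: continuous_cos.
rewrite cos0 divr_gt0// => /(_ isT)[e /= e0 he].
exists (e / 2); first by rewrite divr_gt0.
have pos (x : R) : 0 <= x -> x <= e / 2 -> x <= 2 * sin x.
  move=> x0 xe.
  have [|c] := @MVT_segment R sin cos 0 x x0 (fun y _ => is_derive_sin y).
    by apply: continuous_subspaceT => y; exact: continuous_sin.
  rewrite in_itv/= sin0 !subr0 => /andP[c0 cx] ->.
  have : `|1 - cos c| < 1 / 2.
    by apply: he; rewrite /= sub0r normrN ger0_norm// (le_lt_trans (le_trans cx xe))// ltr_pdivrMr// ltr_pMr// ltr1n.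
  rewrite ltr_norml => /andP[_ h]; rewrite -{1}[x]mul1r mulrA ler_wpM2r//; lra.
move=> x xe; have [x0|x0] := leP 0 x.
  by rewrite {1}ger0_norm// (le_trans (pos x x0 _)) ?(le_trans (ler_norm x))// ler_pM2l// ler_norm.
rewrite -normrN -(normrN (sin x)) -sinN {1}ger0_norm ?oppr_ge0 ?(ltW x0)//.
rewrite (le_trans (pos (- x) _ _)) ?oppr_ge0 ?(ltW x0)//.
  by rewrite (le_trans (ler_norm _))// normrN.
by rewrite ler_pM2l// ler_norm.
Qed.

Definition lipschitz_upto (t K : R) (f : R -> R) :=
  forall u v, 0 <= u -> u <= v -> v <= t -> `|f v - f u| <= K * (v - u).

(* A small increment of Phi is controlled by its sine, hence by the increments of
   x and y; by the intermediate value theorem, an increment over a short time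
   cannot be large. *)
Lemma continuous_angle_absolutely_continuous (t K : R) (x y Phi : R -> R) : 0 <= K ->
  continuous_angle t x y Phi ->
  lipschitz_upto t K x -> lipschitz_upto t K y -> absolutely_continuous 0 t Phi.
Proof.
move=> K0 [_ cPhi PhiE] xK yK; have [eta eta0 heta] := le_sin.
(* In the constant 4, one factor 2 comes from [le_sin] and the other from the two increments, of [x]
   and of [y]. *)
have small u v : 0 <= u -> u <= v -> v <= t -> `|Phi v - Phi u| <= eta ->
    `|Phi v - Phi u| <= 4 * K * (v - u).
  move=> u0 uv vt hPhi; rewrite (le_trans (heta _ hPhi))//.
  have [cu su] := PhiE u (introT andP (conj u0 (le_trans uv vt))).
  have [cv sv] := PhiE v (introT andP (conj (le_trans u0 uv) vt)).
  have [hx hy] := (xK u v u0 uv vt, yK u v u0 uv vt).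
  rewrite sinB.
  have -> : sin (Phi v) * cos (Phi u) - cos (Phi v) * sin (Phi u) =
      (y v - y u) * cos (Phi u) - (x v - x u) * sin (Phi u) by rewrite cu su cv sv; ring.
  have h1 : `|(y v - y u) * cos (Phi u)| <= K * (v - u).
    rewrite normrM (le_trans _ hy)// ler_piMr//; exact: cos_max.
  have h2 : `|(x v - x u) * sin (Phi u)| <= K * (v - u).
    rewrite normrM (le_trans _ hx)// ler_piMr//; exact: sin_max.
  have := ler_normB ((y v - y u) * cos (Phi u)) ((x v - x u) * sin (Phi u)); lra.
have K1 : 0 < 4 * K + 1 by rewrite ltr_wpDl// mulr_ge0.
(* On intervals this short [4 * K * (v - u) < eta], so an increment equal to [eta] at an
   intermediate time would contradict [small]. *)
apply: (@locally_lipschitz_absolutely_continuous t (4 * K) (eta / (4 * K + 1))).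
- by rewrite mulr_ge0.
- by rewrite divr_gt0.
move=> u v u0 uv vt; rewrite ltr_pdivlMr// => uvd; apply: (small) => //.
rewrite leNgt; apply/negP => big.
have lt4 : 4 * K * (v - u) < eta.
  by rewrite mulrC (le_lt_trans _ uvd)// ler_wpM2l ?subr_ge0// lerDl.
have cg : {within `[u, v], continuous (fun s => `|Phi s - Phi u|)}.
  have cPhi' : {within `[u, v], continuous Phi}.
    apply: (continuous_subspaceW _ cPhi) => s /=.
    rewrite !in_itv/= => /andP[us sv].
    by rewrite (le_trans u0 us) (le_trans sv vt).
  move=> s; apply: cvg_norm; apply: cvgB; [exact: cPhi'|exact: cvg_cst].
have [|s] := @IVT _ (fun s => `|Phi s - Phi u|) u v eta uv cg.
  by rewrite subrr normr0 ge_min le_max (ltW eta0) (ltW big) orbT.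
rewrite in_itv/= => /andP[us sv] gs.
have := small u s u0 us (le_trans sv vt); rewrite gs => /(_ (lexx _)) h.
have : 4 * K * (s - u) <= 4 * K * (v - u) by rewrite ler_wpM2l ?mulr_ge0// lerD2r.
lra.
Qed.

Lemma lipschitz_upto_continuous t K f : 0 <= K -> lipschitz_upto t K f ->
  {within `[0, t], continuous f}.
Proof.
move=> K0 fK; apply/subspace_continuousP => x; rewrite /= in_itv/= => /andP[x0 xt].
apply/cvgrPdist_lt => eps eps0; have K1 : 0 < K + 1 by rewrite ltr_wpDl.
rewrite near_withinE; near=> y; rewrite /= in_itv/= => /andP[y0 yt].
have : `|x - y| * (K + 1) < eps.
  rewrite -ltr_pdivlMr//; near: y.
  by apply/nbhs_ballP; exists (eps / (K + 1)) => //=; rewrite divr_gt0.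
apply: le_lt_trans; have [xy|/ltW yx] := leP x y.
  by rewrite distrC (le_trans (fK x y x0 xy yt))// mulrC distrC ger0_norm ?subr_ge0// ler_wpM2l ?subr_ge0// lerDl.
by rewrite (le_trans (fK y x y0 yx xt))// mulrC ger0_norm ?subr_ge0// ler_wpM2l ?subr_ge0// lerDl.
Unshelve. all: by end_near.
Qed.

Lemma lipschitz_uptoN t K f : lipschitz_upto t K f -> lipschitz_upto t K (fun u => - f u).
Proof. by move=> fK u v u0 uv vt; rewrite -opprD normrN fK. Qed.

Lemma lipschitz_uptoD t K L f g : lipschitz_upto t K f -> lipschitz_upto t L g ->
  lipschitz_upto t (K + L) (fun u => f u + g u).
Proof.
move=> fK gL u v u0 uv vt; rewrite opprD addrACA mulrDl (le_trans (ler_normD _ _))//.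
by rewrite lerD ?fK ?gL.
Qed.

Lemma lipschitz_uptoM t K L A C f g : lipschitz_upto t K f -> lipschitz_upto t L g ->
  (forall u, 0 <= u <= t -> `|f u| <= A) -> (forall u, 0 <= u <= t -> `|g u| <= C) ->
  lipschitz_upto t (A * L + C * K) (fun u => f u * g u).
Proof.
move=> fK gL fA gC u v u0 uv vt.
have -> : f v * g v - f u * g u = f v * (g v - g u) + g u * (f v - f u) by ring.
rewrite (le_trans (ler_normD _ _))// !normrM mulrDl -!mulrA lerD// ler_pM//.
- by rewrite fA// (le_trans u0 uv).
- exact: gL.
- by rewrite gC// u0 (le_trans uv vt).
- exact: fK.
Qed.

Lemma lipschitz_uptoV t K m f : 0 < m -> lipschitz_upto t K f ->
  (forall u, 0 <= u <= t -> m <= f u) -> lipschitz_upto t (m^-1 ^+ 2 * K) (fun u => (f u)^-1).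
Proof.
move=> m0 fK fm u v u0 uv vt.
have mu : m <= f u by rewrite fm// u0 (le_trans uv vt).
have mv : m <= f v by rewrite fm// (le_trans u0 uv).
have fu0 := lt_le_trans m0 mu; have fv0 := lt_le_trans m0 mv.
have -> : (f v)^-1 - (f u)^-1 = - ((f u)^-1 * (f v)^-1 * (f v - f u)).
  by field; rewrite !gt_eqF.
rewrite normrN normrM -mulrA ler_pM//; last exact: fK.
rewrite gtr0_norm ?mulr_gt0 ?invr_gt0// expr2 ler_pM ?invr_ge0 ?(ltW fu0) ?(ltW fv0)// lef_pV2//.
Qed.

(** The delicate operation is the division by r. Being continuous and nonzero on a compact interval,
    r has a positive minimum [m] there. *)
Lemma noise_phases_lipschitz t K c s : 0 <= t -> 0 <= K ->
  lipschitz_upto t K c -> lipschitz_upto t K s ->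
  lipschitz_upto t K (fun u => coherence (c u) (s u)) ->
  lipschitz_upto t K (fun u => Num.sqrt (1 - coherence (c u) (s u) ^+ 2)) ->
  (forall u, 0 <= u <= t -> coherence (c u) (s u) <= 1) ->
  (forall u, 0 <= u <= t -> coherence (c u) (s u) != 0) ->
  exists2 L, 0 <= L & 
    [/\ lipschitz_upto t L (fun u => c u + beta (c u) (s u) * s u),
      lipschitz_upto t L (fun u => s u - beta (c u) (s u) * c u),
      lipschitz_upto t L (fun u => c u - beta (c u) (s u) * s u) &
      lipschitz_upto t L (fun u => s u + beta (c u) (s u) * c u)].
Proof.
move=> t0 K0 cK sK rK gK r1 r0.
have cs_le u : `|c u| <= coherence (c u) (s u) /\ `|s u| <= coherence (c u) (s u).
  by rewrite -!sqrtr_sqr !ler_sqrt ?addr_ge0 ?sqr_ge0// lerDl lerDr !sqr_ge0.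
have cs1 u (h : 0 <= u <= t) : `|c u| <= 1 /\ `|s u| <= 1.
  by have [h1 h2] := cs_le u; rewrite (le_trans h1) ?(le_trans h2) ?r1.
have [m m0 hm] : exists2 m, 0 < m & forall u, 0 <= u <= t -> m <= coherence (c u) (s u).
  have [|x] := @EVT_min R (fun u => coherence (c u) (s u)) 0 t t0.
    exact: lipschitz_upto_continuous rK.
  rewrite in_itv/= => hx hmin; exists (coherence (c x) (s x)) => [|u ut].
    by rewrite lt_def r0// sqrtr_ge0.
  exact: hmin.
have bK : lipschitz_upto t (1 * (m^-1 ^+ 2 * K) + m^-1 * K) (fun u => beta (c u) (s u)).
  apply: lipschitz_uptoM => //; first exact: lipschitz_uptoV.
  - move=> u ut; rewrite ger0_norm ?sqrtr_ge0// -[leRHS]sqrtr1 ler_sqrt// lerBlDr lerDl sqr_ge0//.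
  - by move=> u ut; rewrite ger0_norm ?invr_ge0 ?sqrtr_ge0// lef_pV2 ?hm// posrE (lt_le_trans m0)// hm.
have b1 u : 0 <= u <= t -> `|beta (c u) (s u)| <= m^-1.
  move=> ut; rewrite normrM -[leRHS]mul1r ler_pM//.
    by rewrite ger0_norm ?sqrtr_ge0// -[leRHS]sqrtr1 ler_sqrt// lerBlDr lerDl sqr_ge0.
  by rewrite ger0_norm ?invr_ge0 ?sqrtr_ge0// lef_pV2 ?hm// posrE (lt_le_trans m0)// hm.
have cs1' := (fun u h => (cs1 u h).1, fun u h => (cs1 u h).2).
(* One constant for all four functions: the product rule with |beta| at most [m^-1] and |c|, |s| at
   most 1. *)
exists (K + (m^-1 * K + 1 * (1 * (m^-1 ^+ 2 * K) + m^-1 * K))).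
  have i0 : 0 <= m^-1 by rewrite invr_ge0 ltW.
  by rewrite !(addr_ge0, mulr_ge0)// ?exprn_ge0.
split.
- apply: lipschitz_uptoD => //; exact: (lipschitz_uptoM bK sK b1 cs1'.2).
- apply: lipschitz_uptoD => //; apply: lipschitz_uptoN; exact: (lipschitz_uptoM bK cK b1 cs1'.1).
- apply: lipschitz_uptoD => //; apply: lipschitz_uptoN; exact: (lipschitz_uptoM bK sK b1 cs1'.2).
- apply: lipschitz_uptoD => //; exact: (lipschitz_uptoM bK cK b1 cs1'.1).
Qed.

End phases.

(** * Exponential of sigma_z *)

Section exponential.
Context {R : realType}.

Lemma cvg_mx {K : numFieldType} m n (F : nat -> 'M[K]_(m, n)) (L : 'M[K]_(m, n)) :
  (forall a b, (fun k => F k a b : K^o) @ \oo --> (L a b : K^o)) -> F @ \oo --> L.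
Proof.
move=> FL A [P PL PA]; rewrite /= nbhs_filterE/=.
have : \forall k \near \oo, forall a b, P a b (F k a b).
  apply: filter_forall => a; apply: filter_forall => b; exact: FL.
by apply: filterS => k h; apply: PA.
Qed.

Lemma lim_mx {K : numFieldType} m n (F : nat -> 'M[K]_(m.+1, n.+1)) (L : 'M[K]_(m.+1, n.+1)) :
  (forall a b, (fun k => F k a b : K^o) @ \oo --> (L a b : K^o)) -> limn F = L.
Proof. by move=> /cvg_mx FL; apply: cvg_lim FL; exact: norm_hausdorff. Qed.

(** The library series of cos and sin run over all [k], with zero coefficients at every other index,
    so they combine term by term. *)
Lemma expr_iM_fact (x : R) k :
  (k`!%:R)^-1 * ('i%C * x%:C) ^+ k = (cos_coeff x k)%:C + 'i%C * (sin_coeff x k)%:C :> R[i].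
Proof.
have ii : 'i%C * 'i%C = -1 :> R[i] by rewrite -expr2 sqr_i.
rewrite exprMn /cos_coeff /sin_coeff/= -rmorphXn/=.
set m := (k./2); have kE := odd_double_half k.
have iE : 'i%C ^+ k = ((~~ odd k)%:R * (-1) ^+ k./2 : R)%:C +
    'i%C * ((odd k)%:R * (-1) ^+ k.-1./2 : R)%:C :> R[i].
  rewrite -{1}kE exprD -mul2n exprM expr2 ii.
  case: (odd k) kE => /= kE.
    have -> : k.-1./2 = k./2 by rewrite -{1}kE add1n /= doubleK.
    by rewrite expr1 mul1r mul0r rmorph0 add0r rmorphXn/= rmorphN1.
  by rewrite expr0 !mul1r mul0r rmorph0 mulr0 addr0 rmorphXn/= rmorphN1.
rewrite iE -exprnP !(rmorphM, fmorphV)/= !rmorph_nat; ring.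
Qed.

Lemma cvg_exp_imaginary (x : R) :
  ((fun n => \sum_(0 <= k < n) (k`!%:R)^-1 * ('i%C * x%:C) ^+ k) : nat -> R[i]^o) @ \oo
    --> ((cos x)%:C + 'i%C * (sin x)%:C : R[i]^o).
Proof.
have cx : series (cos_coeff x) @ \oo --> cos x.
  by rewrite unlock; exact: is_cvg_series_cos_coeff.
have sx : series (sin_coeff x) @ \oo --> sin x.
  by rewrite unlock; exact: is_cvg_series_sin_coeff.
rewrite (_ : (fun n => _) = (fun n => (series (cos_coeff x) n)%:C : R[i]^o) +
    (fun n => 'i%C * (series (sin_coeff x) n)%:C : R[i]^o)).
  apply: (@cvgD _ R[i]^o); first exact: cvg_realcomplex.
  by apply: cvg_complexM; exact: cvg_realcomplex.
apply/funext => n.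
rewrite -[RHS]/((series (cos_coeff x) n)%:C + 'i%C * (series (sin_coeff x) n)%:C) /series/= !rmorph_sum/= mulr_sumr -big_split/=.
by apply: eq_bigr => k _; rewrite expr_iM_fact.
Qed.

Lemma sigma_z_expr (z : R[i]) k : (z *: sigma_z R) ^+ k =
  \matrix_(a, b) (if a == b then (if a == 0 then z else - z) ^+ k else 0).
Proof.
elim: k => [|k IH].
  by apply/matrixP => a b; rewrite !mxE; case: (a == b).
apply/matrixP => a b; rewrite exprSr IH mxE (bigD1 a)//= big1 => [|j ja]; last first.
  by rewrite !mxE eq_sym (negbTE ja) mul0r.
by rewrite addr0 !mxE eqxx; case: (a == b); rewrite /= ?mulr0// exprSr; case: (a == 0); rewrite ?mulr1 ?mulrN1.
Qed.

Lemma expm_sigma_z (x : R) : expm ((- 'i%C * x%:C) *: sigma_z R) =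
  \matrix_(a, b) (if a == b then (cos x)%:C + (if a == 0 then - 'i%C else 'i%C) * (sin x)%:C else 0).
Proof.
rewrite /expm; apply: (@lim_mx R[i]) => a b.
rewrite (_ : (fun _ => _) = (fun n => \sum_(0 <= k < n) (k`!%:R)^-1 *
    (if a == b then ('i%C * (if a == 0 then - x else x)%:C) ^+ k else 0))); last first.
  apply/funext => n; rewrite /series/= summxE; apply: eq_bigr => k _.
  rewrite sigma_z_expr !mxE; case: (a == b) => //; case: (a == 0); congr (_ * _ ^+ _).
    by rewrite rmorphN/= mulrN mulNr.
  by rewrite mulNr opprK.
rewrite mxE; case: (a == b); last first.
  rewrite (_ : (fun _ => _) = cst 0); first exact: cvg_cst.
  by apply/funext => n; rewrite big1// => k _; rewrite mulr0.
have -> : (cos x)%:C + (if a == 0 then - 'i%C else 'i%C) * (sin x)%:C =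
    (cos (if a == 0 then - x else x))%:C + 'i%C * (sin (if a == 0 then - x else x))%:C :> R[i].
  by case: (a == 0) => //; rewrite cosN sinN rmorphN/= mulrN mulNr.
exact: cvg_exp_imaginary.
Qed.

End exponential.

(** * Transfer matrix and noise model *)

Section qubit.
Context {R : realType}.

Lemma absolutely_continuous_noise_history (B t : R) (Phi : R -> R) : 0 <= t -> Phi 0 = 0 ->
  absolutely_continuous 0 t Phi ->
  noise_history t Phi (fun u => derive1 Phi u + B) /\
  (\int[@lebesgue_measure R]_(x in `[0, t]) (- B + (derive1 Phi x + B)))%R = Phi t.
Proof.
move=> t0 Phi0 /(absolutely_continuous_FTC t0)[dPhi iPhi PhiE]; split; first split=> //.
- have -> : EFin \o (fun u => derive1 Phi u + B) = (EFin \o derive1 Phi) \+ (EFin \o cst B).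
    by apply/funext => x /=; rewrite EFinD.
  apply: integrableD => //; apply: continuous_compact_integrable; first exact: segment_compact.
  by move=> x; exact: cvg_cst.
- rewrite -[RHS]subr0 -[in RHS]Phi0 -PhiE; congr (Rintegral _ _ _).
  by apply/funext => x; ring.
Qed.

Lemma ord2P (a : 'I_2) : a = 0 \/ a = 1.
Proof. by case: a => [[|[|//]]] h; [left|right]; exact: val_inj. Qed.

Definition phase_damping (w : R[i]) (rho : 'M[R[i]]_2) : 'M[R[i]]_2 :=
  \matrix_(a, b) (rho a b * (if a == b then 1 else if a == 0 then w else w^*)).

(** The minus sign comes from the entry 0 1 of a qubit matrix being (n_x - i n_y)/2: a rotation of
    (n_x, n_y) with cosine c and sine s multiplies it by c - i s. *)
Definition phase_factor (c s : R) : R[i] := c%:C - 'i%C * s%:C.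

Lemma phase_factorC (c s : R) : (phase_factor c s)^* = c%:C + 'i%C * s%:C.
Proof.
by rewrite conjcE; apply/eqP; rewrite eq_complex; apply/andP; split; apply/eqP => /=; ring.
Qed.

(** U is diagonal with entries exp(-i theta/2) and exp(i theta/2), so conjugation multiplies the
    coherence by exp(-i theta); the double angle formulas express this in real terms. *)
Lemma noise_evolution_phase_damping (B t theta : R) (h : R -> R) (rho : 'M[R[i]]_2) :
  (\int[@lebesgue_measure R]_(x in `[0, t]) (- B + h x))%R = theta ->
  let U := noise_evolution B h t in
  U *m rho *m (U ^t Num.conj)%sesqui = phase_damping (phase_factor (cos theta) (sin theta)) rho.
Proof.
move=> hE U; pose u (a : 'I_2) : R[i] :=
  (cos (theta / 2))%:C + (if a == 0 then - 'i%C else 'i%C) * (sin (theta / 2))%:C.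
have UE : U = \matrix_(a, b) (if a == b then u a else 0).
  rewrite /U /noise_evolution hE.
  have -> : - ('i%C / 2) * theta%:C = - 'i%C * (theta / 2)%:C :> R[i].
    by rewrite rmorphM/= fmorphV/= rmorph_nat; ring.
  by rewrite expm_sigma_z.
have UrhoU a b : (U *m rho *m (U ^t Num.conj)%sesqui) a b = rho a b * (u a * (u b)^*).
  rewrite mxE (bigD1 b)//= big1 => [|j jb]; last first.
    by rewrite UE !mxE eq_sym (negbTE jb) rmorph0 mulr0.
  rewrite addr0 mxE (bigD1 a)//= big1 => [|j ja]; last first.
    by rewrite UE !mxE eq_sym (negbTE ja) mul0r.
  by rewrite UE !mxE !eqxx addr0; ring.
apply/matrixP => a b; rewrite UrhoU !mxE; congr (_ * _).
have cs1 := cos2Dsin2 (theta / 2).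
have thE : theta = theta / 2 + theta / 2 by rewrite -splitr.
have cE : cos theta = cos (theta / 2) ^+ 2 - sin (theta / 2) ^+ 2 by rewrite {1}thE cosD; ring.
have sE : sin theta = 2 * (sin (theta / 2) * cos (theta / 2)) by rewrite {1}thE sinD; ring.
rewrite /phase_factor /u cE sE; move: (cos _) (sin _) cs1 => x y cs1.
have [->|->] := ord2P a; have [->|->] := ord2P b; rewrite /= !conjcE; apply/eqP; rewrite eq_complex; apply/andP; split; apply/eqP => /=.
all: rewrite ?oppr0 ?mul0r ?mulr0 ?mul1r ?mulN1r ?subr0 ?add0r ?addr0.
all: try ring.
all: rewrite -?cs1; try ring.
Qed.

Lemma bloch_vectorP (rho : 'M[R[i]]_2) (n : 'cV[R]_4) :
  let m k := (n (inord k) 0)%:C in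
  bloch_vector rho n <->
  [/\ rho 0 0 = 2^-1 * (m 0%N + m 3%N), rho 1 1 = 2^-1 * (m 0%N - m 3%N),
      rho 0 1 = 2^-1 * (m 1%N - 'i%C * m 2%N) & rho 1 0 = 2^-1 * (m 1%N + 'i%C * m 2%N)].
Proof.
have big4 (F : 'I_4 -> 'M[R[i]]_2) : \sum_k F k = F (inord 0) + F (inord 1) + F (inord 2) + F (inord 3).
  rewrite !big_ord_recl big_ord0 addr0 !addrA.
  by congr (_ + _ + _ + _); congr F; apply/val_inj; rewrite /= inordK.
rewrite /bloch_vector big4 /pauli !inordK//=.
move: (n (inord 0) 0)%:C (n (inord 1) 0)%:C (n (inord 2) 0)%:C (n (inord 3) 0)%:C => m0 m1 m2 m3.
have E : 2^-1 *: (m0 *: 1%:M + m1 *: sigma_x R + m2 *: sigma_y R + m3 *: sigma_z R) =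
    \matrix_(a, b) (if a == 0 then if b == 0 then 2^-1 * (m0 + m3) else 2^-1 * (m1 - 'i%C * m2)
       else if b == 0 then 2^-1 * (m1 + 'i%C * m2) else 2^-1 * (m0 - m3)).
  apply/matrixP => a b; have [->|->] := ord2P a; have [->|->] := ord2P b; rewrite !mxE /=; ring.
rewrite E; split=> [->|[h1 h2 h3 h4]]; first by rewrite !mxE.
by apply/matrixP => a b; have [->|->] := ord2P a; have [->|->] := ord2P b; rewrite mxE.
Qed.

(** A rotation about the z axis when c^2 + s^2 = 1; in general the equatorial plane is also scaled
    by r. *)
Definition bloch_rotation (c s : R) : 'M[R]_4 := \matrix_(j, k) nth 0 (nth [::]
  [:: [:: 1; 0; 0; 0]; [:: 0; c; - s; 0]; [:: 0; s; c; 0]; [:: 0; 0; 0; 1]] j) k.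

Lemma phase_damping_transfer c s :
  transfer_matrix (phase_damping (phase_factor c s)) (bloch_rotation c s).
Proof.
move=> rho n _ /bloch_vectorP[h1 h2 h3 h4]; apply/bloch_vectorP => /=.
have big4 (F : 'I_4 -> R) : \sum_k F k = F (inord 0) + F (inord 1) + F (inord 2) + F (inord 3).
  rewrite !big_ord_recl big_ord0 addr0 !addrA.
  by congr (_ + _ + _ + _); congr F; apply/val_inj; rewrite /= inordK.
rewrite !mxE !big4 !mxE !inordK//= h1 h2 h3 h4 /phase_factor.
have ii : 'i%C * 'i%C = -1 :> R[i] by rewrite -expr2 sqr_i.
rewrite -/(phase_factor c s) phase_factorC !(mul0r, mul1r, add0r, addr0, mulr1).
by rewrite /phase_factor !rmorphD/= !rmorphM/= !rmorphN/=; split=> //; ring: ii.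
Qed.

Lemma bloch_vector_inj (rho : 'M[R[i]]_2) (n n' : 'cV[R]_4) :
  bloch_vector rho n -> bloch_vector rho n' -> n = n'.
Proof.
move=> /bloch_vectorP[h1 h2 h3 h4] /bloch_vectorP[]; rewrite h1 h2 h3 h4 => {h1 h2 h3 h4}.
have i2 : (2%:R^-1 : R[i]) != 0 by rewrite invr_eq0 pnatr_eq0.
move=> /(mulfI i2) e1 /(mulfI i2) e2 /(mulfI i2) e3 /(mulfI i2) e4.
have [e1r e2r] := (congr1 (@complex.Re R) e1, congr1 (@complex.Re R) e2).
have [e3r e3i] := (congr1 (@complex.Re R) e3, congr1 (@complex.Im R) e3).
move: e1r e2r e3r e3i; rewrite /= => e1r e2r e3r e3i.
suff E k : (k < 4)%N -> n (inord k) 0 = n' (inord k) 0.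
  apply/matrixP => j k; rewrite ord1 -(inord_val j); exact: E.
by case: k => [|[|[|[|//]]]] _; lra.
Qed.

(* The maximally mixed state for [k = 0], a pure state otherwise. *)
Definition pure_bloch (k : 'I_4) : 'cV[R]_4 := \col_j ((j == 0) || (j == k))%:R.

(** For Hermitian [rho] the square is [rho] times its adjoint, hence positive. *)
Lemma density_matrix_scaled_square (rho : 'M[R[i]]_2) (k : R) : 0 <= k ->
  (rho ^t Num.conj = rho)%sesqui -> rho = k%:C *: (rho *m rho) -> \tr rho = 1 ->
  density_matrix rho.
Proof.
move=> k0 rhoH rhoE tr1; split=> // v.
rewrite rhoE -{1}rhoH -scalemxAr -scalemxAl mulmxA -map_mxM/= -trmx_mul -mulmxA mxE.
rewrite mulr_ge0 ?ler0c// mxE sumr_ge0// => j _.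
by rewrite !mxE mulrC mul_conj ler0c exprn_ge0// nr_ge0.
Qed.

Lemma pure_bloch_density k : exists2 rho, density_matrix rho & bloch_vector rho (pure_bloch k).
Proof.
suff H rho : bloch_vector rho (pure_bloch k) -> density_matrix rho.
  by exists ((2^-1) *: \sum_j ((pure_bloch k) j 0)%:C *: pauli R j) => //; exact: H.
have E j : (j < 4)%N -> pure_bloch k (inord j) 0 = ((j == 0)%N || (j == k :> nat))%:R.
  by move=> j4; rewrite mxE -!(inj_eq val_inj) /= inordK.
move=> /bloch_vectorP; rewrite /= !E//= => -[h1 h2 h3 h4].
have big2 (F : 'I_2 -> R[i]) : \sum_j F j = F 0 + F 1.
  by rewrite !big_ord_recl big_ord0 addr0; congr (_ + F _); exact: val_inj.
have ii : 'i%C * 'i%C = -1 :> R[i] by rewrite -expr2 sqr_i.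
(* The maximally mixed state squares to half of itself, while a pure state is a projection. *)
apply: (@density_matrix_scaled_square _ (if k == 0 then 2 else 1)).
- by case: ifP.
- apply/matrixP => a b; rewrite !mxE.
  have [->|->] := ord2P a; have [->|->] := ord2P b; rewrite ?h1 ?h2 ?h3 ?h4 conjcE;
    apply/eqP; rewrite eq_complex; apply/andP; split; apply/eqP => /=; by field.
- have -> : (k == 0) = (0%N == k :> nat) by rewrite eq_sym.
  apply/matrixP => a b; rewrite !mxE big2.
  case: k h1 h2 h3 h4 {E} => [[|[|[|[|//]]]] hk]/=; rewrite ?rmorph1 ?rmorph0 => h1 h2 h3 h4;
  have [->|->] := ord2P a; have [->|->] := ord2P b; rewrite ?h1 ?h2 ?h3 ?h4 ?rmorph_nat; by field: ii.
- by rewrite /mxtrace big2 h1 h2; field.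
Qed.

(** A transfer matrix is constrained on Bloch vectors of states only, but four of these already span
    R^4: the maximally mixed one gives column 0, and each pure one gives column 0 plus another
    column. *)
Lemma transfer_matrix_unique Lambda (T T' : 'M[R]_4) :
  transfer_matrix Lambda T -> transfer_matrix Lambda T' -> T = T'.
Proof.
move=> hT hT'.
have E k : T *m pure_bloch k = T' *m pure_bloch k.
  have [rho drho brho] := pure_bloch_density k.
  exact: bloch_vector_inj (hT _ _ drho brho) (hT' _ _ drho brho).
have pE k (M : 'M[R]_4) j : (M *m pure_bloch k) j 0 = M j 0 + (k != 0)%:R * M j k.
  rewrite mxE (bigD1 0)//= mxE eqxx mulr1; congr (_ + _).
  have [->|k0] := eqVneq k 0.
    by rewrite mul0r big1// => i i0; rewrite mxE (negbTE i0) mulr0.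
  rewrite (bigD1 k)//= mxE eqxx orbT mulr1 mul1r big1 ?addr0// => i /andP[i0 ik].
  by rewrite mxE (negbTE i0) (negbTE ik) mulr0.
apply/matrixP => j k; have := congr1 (fun M : 'cV_4 => M j 0) (E k); have := congr1 (fun M : 'cV_4 => M j 0) (E 0).
rewrite !pE eqxx !mul0r !addr0 => h0; have [->//|k0] := eqVneq k 0.
by rewrite h0 !mul1r => /addrI.
Qed.

Lemma dist_nr (z w : R[i]) : `|nr z - nr w| <= nr (z - w).
Proof.
have := nrD (z - w) w; have := nrD (w - z) z; rewrite !subrK nrB ler_norml; lra.
Qed.

Lemma phase_damping_mean (w1 w2 w : R[i]) rho : w1 + w2 = 2 * w ->
  phase_damping w rho = 2^-1 *: phase_damping w1 rho + 2^-1 *: phase_damping w2 rho.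
Proof.
move=> ww; have -> : w = 2^-1 * (w1 + w2) by rewrite ww; field.
apply/matrixP => a b; rewrite !mxE.
by case: (a == b); case: (a == 0); rewrite ?rmorphM ?rmorphD ?fmorphV ?rmorph_nat; field.
Qed.

Lemma bloch_rotation_xx c s : bloch_rotation c s idx_x idx_x = c.
Proof. by rewrite mxE !inordK. Qed.

Lemma bloch_rotation_yy c s : bloch_rotation c s idx_y idx_y = c.
Proof. by rewrite mxE !inordK. Qed.

Lemma bloch_rotation_yx c s : bloch_rotation c s idx_y idx_x = s.
Proof. by rewrite mxE !inordK. Qed.

Lemma bloch_rotation_xy c s : bloch_rotation c s idx_x idx_y = - s.
Proof. by rewrite mxE !inordK. Qed.

Lemma coherence_nr (w : R[i]) : coherence (complex.Re w) (- complex.Im w) = nr w.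
Proof. by rewrite /coherence sqrrN -nr_sqr sqrtr_sqr ger0_norm// nr_ge0. Qed.

Lemma phase_factor_Re_Im (w : R[i]) : phase_factor (complex.Re w) (- complex.Im w) = w.
Proof. by case: w => x y; apply/eqP; rewrite eq_complex; apply/andP; split; apply/eqP => /=; ring. Qed.

End qubit.

Unset Implicit Arguments.

Theorem mainTheorem1 (R : realType) (V : completeNormedModType R[i])
    (dot : {dot V for Num.conj}) (I : choiceType) (e : I -> V)
    (B : R) (HB HSB : R -> partial_operator V)
    (UQ : R -> ('I_2 -> V) -> ('I_2 -> V)) (rhoB : V -> V)
    (hV : hilbert_space dot) (he : orthonormal_basis dot e)
    (hHB : forall t : R, 0 <= t -> hermitian_operator dot (HB t))
    (hHSB : forall t : R, 0 <= t -> hermitian_operator dot (HSB t))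
    (hUQ : evolution_operator dot (fun t => dephasing_hamiltonian B (HB t) (HSB t)) UQ)
    (hrhoB : density_operator dot e rhoB) :
  let rhoQ t rhoS := reduced_state dot e (UQ t) rhoS rhoB in
  exists T : R -> 'M[R]_4,
    [/\ forall t : R, 0 <= t -> transfer_matrix (rhoQ t) (T t) /\
          forall T', transfer_matrix (rhoQ t) T' -> T' = T t,
        forall t : R, 0 <= t ->
          T t idx_x idx_x = T t idx_y idx_y /\
          T t idx_y idx_x = - T t idx_x idx_y
      & let c t := T t idx_x idx_x in
        let s t := T t idx_y idx_x in
        let b t := beta (c t) (s t) in
        forall (t : R) (Phi1 Phi2 : R -> R), 0 <= t ->
          (forall u : R, 0 <= u <= t -> coherence (c u) (s u) != 0) ->
          continuous_angle t (fun u : R => c u + b u * s u) (fun u : R => s u - b u * c u) Phi1 ->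
          continuous_angle t (fun u : R => c u - b u * s u) (fun u : R => s u + b u * c u) Phi2 ->
          bounded_on HSB t \/
            (absolutely_continuous 0 t Phi1 /\ absolutely_continuous 0 t Phi2) ->
          let h1 u := derive1 Phi1 u + B in
          let h2 u := derive1 Phi2 u + B in
          let U1 := noise_evolution B h1 t in
          let U2 := noise_evolution B h2 t in
          [/\ noise_history t Phi1 h1, noise_history t Phi2 h2
            & forall rhoS, density_matrix rhoS ->
                rhoQ t rhoS =
                  2^-1 *: (U1 *m rhoS *m (U1 ^t Num.conj)%sesqui) +
                  2^-1 *: (U2 *m rhoS *m (U2 ^t Num.conj)%sesqui)]].
Proof.
have [W [WE WK]] := reduced_state_coherence hV hHB hHSB hUQ he hrhoB.
have WE' t rhoS : 0 <= t -> reduced_state dot e (UQ t) rhoS rhoB =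
    phase_damping (phase_factor (complex.Re (W t)) (- complex.Im (W t))) rhoS.
  by move=> t0; rewrite phase_factor_Re_Im WE.
(* From W = c - i s: c is the real part of W, and s is minus its imaginary part. *)
move=> rhoQ; exists (fun t => bloch_rotation (complex.Re (W t)) (- complex.Im (W t))).
have TQ t : 0 <= t -> transfer_matrix (rhoQ t) (bloch_rotation (complex.Re (W t)) (- complex.Im (W t))).
  by move=> t0 rho n drho hn; rewrite /rhoQ WE'//; exact: phase_damping_transfer.
split=> [t t0|t t0|c s b t Phi1 Phi2 t0 r0 Phi1E Phi2E bAC h1 h2 U1 U2].
- by split=> [|T' hT']; [exact: TQ|exact: transfer_matrix_unique hT' (TQ t t0)].
- by rewrite bloch_rotation_xx bloch_rotation_yy bloch_rotation_yx bloch_rotation_xy opprK.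
have cE : c = fun u => complex.Re (W u) by apply/funext => u; exact: bloch_rotation_xx.
have sE : s = fun u => - complex.Im (W u) by apply/funext => u; exact: bloch_rotation_yx.
have rE u : coherence (c u) (s u) = nr (W u) by rewrite cE sE coherence_nr.
have [AC1 AC2] : absolutely_continuous 0 t Phi1 /\ absolutely_continuous 0 t Phi2.
  case: bAC => // bt; have [K K0 hK] := WK t t0 bt.
  have [||||||L L0 [x1 y1 x2 y2]] := @noise_phases_lipschitz R t K c s t0 K0.
  - move=> u v u0 uv vt; have [_ h _] := hK u v u0 uv vt.
    by rewrite cE -ReB (le_trans (Re_le_nr _)).
  - move=> u v u0 uv vt; have [_ h _] := hK u v u0 uv vt.
    have := le_trans (Im_le_nr (W v - W u)) h.
    by rewrite sE -opprD normrN; case: (W v) (W u) => ? ? [].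
  - move=> u v u0 uv vt; have [_ h _] := hK u v u0 uv vt.
    by rewrite !rE (le_trans (dist_nr _ _)).
  - by move=> u v u0 uv vt; rewrite !rE; have [_ _] := hK u v u0 uv vt.
  - by move=> u /andP[u0 ut]; rewrite rE; have [] := hK u u u0 (lexx u) ut.
  - exact: r0.
  split; first exact: continuous_angle_absolutely_continuous L0 Phi1E x1 y1.
  exact: continuous_angle_absolutely_continuous L0 Phi2E x2 y2.
have [[Phi10 _ /(_ t) cs1] [Phi20 _ /(_ t) cs2]] := (Phi1E, Phi2E).
have tt : 0 <= t <= t by rewrite t0 lexx.
have [nh1 int1] := absolutely_continuous_noise_history B t0 Phi10 AC1.
have [nh2 int2] := absolutely_continuous_noise_history B t0 Phi20 AC2.
split=> // rhoS _; rewrite /rhoQ WE'//.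
have E1 : U1 *m rhoS *m (U1 ^t Num.conj)%sesqui =
    phase_damping (phase_factor (cos (Phi1 t)) (sin (Phi1 t))) rhoS.
  exact: noise_evolution_phase_damping int1.
have E2 : U2 *m rhoS *m (U2 ^t Num.conj)%sesqui =
    phase_damping (phase_factor (cos (Phi2 t)) (sin (Phi2 t))) rhoS.
  exact: noise_evolution_phase_damping int2.
clearbody U1 U2; rewrite E1 E2 {E1 E2}.
have [[-> ->] [-> ->]] := (cs1 tt, cs2 tt).
(* The terms with beta cancel in the sum of the two phase factors, which leaves 2 (c - i s). *)
apply: phase_damping_mean.
have -> : complex.Re (W t) = c t by rewrite cE.
have -> : - complex.Im (W t) = s t by rewrite sE.
by rewrite /phase_factor !(rmorphD, rmorphN); ring.
Qed.
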